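(* Let $n\in\mathbb{N}$, let $\mathcal{O}\subset\mathbb{C}^n$ be an open set, let $v:\mathcal{O}\to[-\infty,+\infty]$ be a weight function locally integrable with respect to Lebesgue measure $\lambda$, and let $\Phi:[-\infty,+\infty]\to[-\infty,+\infty]$ be a convex strictly increasing function. Let $f$ be a holomorphic function on $\mathcal{O}$ for which the Lebesgue integral below is well defined and $$N_\Phi(f;v):=\int_{\mathcal{O}}\Phi\bigl(\ln|f|-v\bigr)\,d\lambda<+\infty .$$ Then for all $z\in\mathcal{O}$ $$\ln|f(z)|\le \inf_{0<r<\operatorname{dist}(z,\mathbb{C}^n\setminus\mathcal{O})}\Bigl(B_v(z,r)+\Phi^{-1}\Bigl(\frac{n!}{\pi^n r^{2n}}\,N_\Phi(f;v)\Bigr)\Bigr).$$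
   Context: $\mathbb{C}^n$ is identified with $\mathbb{R}^{2n}$, $\lambda$ is Lebesgue measure, $B(z,r)$ is the open Euclidean ball of radius $r$ centred at $z$, and $\operatorname{dist}$ is Euclidean distance with $\operatorname{dist}(\cdot,\varnothing):=+\infty$. For $v$ integrable on $B(z,r)$, the mean of $v$ over the ball is $$B_v(z,r):=\frac{1}{\lambda(B(z,r))}\int_{B(z,r)}v\,d\lambda=\frac{n!}{\pi^n r^{2n}}\int_{B(z,r)}v\,d\lambda .$$ $\Phi^{-1}$ denotes the inverse function of the strictly increasing function $\Phi$, and $\ln 0=-\infty$.
   Formalization: The formal theorem additionally assumes Φ(ln|f|−v) ≥ 0 almost everywhere on O; without it the claim fails, e.g. n=1, O={|w|<2}, Φ=id, f=1, v=0 on |w|<1 and v=100 elsewhere, at z=0, r=1. *)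

(* Defs.v *)
From HB Require Import structures.
From mathcomp Require Import all_boot all_order all_algebra.
From mathcomp Require Import complex.
From mathcomp Require Import all_classical all_reals all_analysis.
From mathcomp Require Import measurable_realfun.

Set Implicit Arguments.
Unset Strict Implicit.
Unset Printing Implicit Defensive.

Import Order.TTheory GRing.Theory Num.Theory.
Import numFieldNormedType.Exports.

Local Open Scope classical_set_scope.
Local Open Scope ring_scope.
Local Open Scope complex_scope.

(* R[i] as a bundled numeric field: the topology and the normed-module
   structure of a [numFieldType] are not inferred on the bare type [R[i]]. *)
Definition Cx (R : realType) : numClosedFieldType := R[i].

Notation Cn R n := ('rV[Cx R]_n).

Definition cabs (R : realType) (x : Cx R) : R := complex.Re `|x|.

(* The norm of the library on ['rV[Cx R]_n] is the sup norm: it gives the right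
   topology, but not the Euclidean balls and distance. *)
Definition euclid_norm (R : realType) (n : nat) (z : Cn R n) : R :=
  Num.sqrt (\sum_(k < n) cabs (z 0 k) ^+ 2).

Definition euclid_ball (R : realType) (n : nat) (z : Cn R n) (r : R) : set (Cn R n) :=
  [set w | euclid_norm (w - z) < r].

(* [ereal_inf set0 = +oo] gives the convention for the empty set. *)
Definition euclid_dist (R : realType) (n : nat) (z : Cn R n) (A : set (Cn R n)) :
    \bar R :=
  ereal_inf [set (euclid_norm (w - z))%:E | w in A].

Section lebesgue_measure_Cn.
Local Open Scope ereal_scope.
Context (R : realType).

(* n-fold product of [mu] on the product sigma-algebra of [n.-tuple T]. *)
Fixpoint power_measure d (T : measurableType d) (mu : set T -> \bar R)
    (n : nat) : set (n.-tuple T) -> \bar R :=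
  match n with
  | 0 => fun A => \d_[tuple] A
  | m.+1 => fun A =>
      (mu \x @power_measure d T mu m) [set p | A (cons_tuple p.1 p.2)]
  end.

Lemma power_measure_ge0 d (T : measurableType d) (mu : {measure set T -> \bar R})
    n (A : set (n.-tuple T)) : 0 <= power_measure mu A.
Proof.
elim: n A => [|n IHn] A; first exact: measure_ge0.
by apply: integral_ge0 => x _; exact: IHn.
Qed.

Lemma power_measure0 d (T : measurableType d) (mu : {measure set T -> \bar R})
    n : power_measure mu (set0 : set (n.-tuple T)) = 0.
Proof.
elim: n => [|n IHn]; first exact: measure0.
by apply: integral0_eq => x _ /=; rewrite xsection0.
Qed.

Definition lebesgue2 : set (measurableTypeR R * measurableTypeR R) -> \bar R :=
  @lebesgue_measure R \x @lebesgue_measure R.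

HB.instance Definition _ := Measure.on lebesgue2.

Context (n : nat).

(* The identification of R^2n with C^n. *)
Definition toCn (t : n.-tuple (measurableTypeR R * measurableTypeR R)) :
    Cn R n :=
  \row_(k < n) ((tnth t k).1 +i* (tnth t k).2).

Definition lebesgue_outer (A : set (Cn R n)) : \bar R :=
  ((power_measure lebesgue2 (n := n))^*)%mu (toCn @^-1` A).

Let outer0 : lebesgue_outer set0 = 0.
Proof.
rewrite /lebesgue_outer preimage_set0.
by apply: mu_ext0 => [|X]; [exact: power_measure0|exact: power_measure_ge0].
Qed.

Let outer_ge0 A : 0 <= lebesgue_outer A.
Proof. by apply: mu_ext_ge0 => X; exact: power_measure_ge0. Qed.

Let outer_le : {homo lebesgue_outer : A B / A `<=` B >-> A <= B}.
Proof. by move=> A B AB; apply: le_mu_ext; exact: preimage_subset. Qed.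

Let outer_sigma_subadditive : sigma_subadditive lebesgue_outer.
Proof.
move=> F; rewrite /lebesgue_outer preimage_bigcup.
by apply: mu_ext_sigma_subadditive => X; exact: power_measure_ge0.
Qed.

HB.instance Definition _ := isOuterMeasure.Build R (Cn R n) lebesgue_outer
  outer0 outer_ge0 outer_le outer_sigma_subadditive.

(* C^n carries the Lebesgue, i.e. completed Borel, sigma-algebra. *)
HB.instance Definition _ := Measurable.copy (Cn R n)
  (caratheodory_type lebesgue_outer).

Definition lebesgue_Cn : set (Cn R n) -> \bar R := lebesgue_outer.

HB.instance Definition _ := isMeasure.Build _ (Cn R n) R lebesgue_Cn
  (@caratheodory_measure0 _ _ lebesgue_outer)
  (@caratheodory_measure_ge0 _ _ lebesgue_outer)
  (@caratheodory_measure_sigma_additive _ _ lebesgue_outer).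

End lebesgue_measure_Cn.

Arguments lebesgue_Cn : clear implicits.

Section notions.
Local Open Scope ereal_scope.
Context (R : realType) (n : nat).
Implicit Types (D : set (Cn R n)) (v g : Cn R n -> \bar R).

Local Notation lambda := (lebesgue_Cn R n).

(* Complex differentiability: ['rV[Cx R]_n] is a normed module over [Cx R]. *)
Definition holomorphic_on D (f : Cn R n -> Cx R) : Prop :=
  forall z, D z -> differentiable f z.

Definition locally_integrable_on D v : Prop :=
  measurable_fun D v /\
  forall K : set (Cn R n), compact K -> K `<=` D -> lambda.-integrable K v.

(* [\int] is total, with [+oo - +oo = -oo]: that the Lebesgue integral of [g]
   over [D] is well defined has to be stated. *)
Definition has_integral D g : Prop :=
  measurable_fun D g /\
  (\int[lambda]_(w in D) g^\+ w) +? (- \int[lambda]_(w in D) g^\- w).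

Definition ball_mean v (z : Cn R n) (r : R) : \bar R :=
  (fine (lambda (euclid_ball z r)))^-1%:E * \int[lambda]_(w in euclid_ball z r) v w.

Definition log_abs (f : Cn R n -> Cx R) (w : Cn R n) : \bar R :=
  lne (cabs (f w))%:E.

Definition N_Phi (Phi : \bar R -> \bar R) D f v : \bar R :=
  \int[lambda]_(w in D) Phi (log_abs f w - v w).

End notions.

(* The convexity inequality is required whenever both of its sides make sense
   (no [+oo - +oo]). *)
Definition convex_ereal (R : realType) (Phi : \bar R -> \bar R) : Prop :=
  forall (x y : \bar R) (t : R), 0 < t < 1 ->
    (t%:E * x +? (1 - t)%:E * y)%E ->
    (t%:E * Phi x +? (1 - t)%:E * Phi y)%E ->
    (Phi (t%:E * x + (1 - t)%:E * y) <= t%:E * Phi x + (1 - t)%:E * Phi y)%E.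

(* Main.v *)
Require Import Defs.
From HB Require Import structures.
From mathcomp Require Import all_boot all_order all_algebra.
From mathcomp Require Import complex.
From mathcomp Require Import all_classical all_reals all_analysis.
From mathcomp Require Import measurable_realfun.
From mathcomp Require Import ring lra.

Import Order.TTheory GRing.Theory Num.Theory.
Import numFieldNormedType.Exports.

Local Open Scope classical_set_scope.
Local Open Scope ring_scope.

Set Implicit Arguments.
Unset Strict Implicit.
Unset Printing Implicit Defensive.

(** If f(z) = 0, the left-hand side is -oo. Otherwise let B be a ball of center z
    and radius r whose closure lies in the open set. The function ln |f| is
    subharmonic: it is integrable on B and its mean over B is at least ln |f(z)|
    (log_modulus_submean). As v is integrable on B too, the mean m of ln |f| - v over
    B is a real number, and ln |f(z)| - m is at most the mean of v. Jensen's
    inequality (jensen) bounds Phi(m) times the volume of B by the integral of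
    Phi(ln |f| - v), first over B and then, by nonnegativity, over the open set.
    The volume of B is pi^n r^(2n) / n! (volume_euclid_ball), so Phi(m) is at most
    the argument A of the inverse of Phi in the statement. This A is a real number
    above Phi(m), so it is a value Phi(x) with x >= m (convex_surjective), and the
    inverse of Phi maps it to x.

    Subharmonicity has to be derived from complex differentiability at every point,
    with no regularity of the derivative. For h holomorphic near the closed unit
    disc, h(exp(s + i t)) is holomorphic and periodic in t. Goursat's bisection
    (circulation_eq0) shows that its mean over a period does not depend on s, hence
    that |h(0)| is at most the maximum of |h| on the unit circle
    (maximum_at_center). This is applied to h exp(-p), where the real part of p is a
    Poisson sum with masses at the N-th roots of unity, which approximates a given
    continuous majorant psi of ln |h| on the circle. The outcome is that ln |h(0)|
    is at most the average of psi over the N-th roots of unity, up to an error that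
    tends to 0 and depends on psi only through its bound and modulus of continuity
    (log_submean_roots). In C^n this is used on the complex lines through z, with psi a
    truncation of ln |f|. The ball and the Lebesgue measure are invariant under the
    rotations w |-> z + u (w - z) with |u| = 1, so the integral of psi over B equals
    the integral of these averages (log_trunc_average). Letting N tend to infinity
    and then removing the truncation by monotone convergence (integrable_log) gives
    the claim.

    On the side of the measure, translations and shears preserve plane area, so do
    rotations, and Fubini's theorem extends this to C^n (preserves_motion); the
    volume of a ball is computed by induction on n with the layer cake formula
    (tuple_measure_ball). *)

(** * The complex plane *)

Section modulus.
Context (R : realType).
Implicit Types x y z : Cx R.
Local Open Scope complex_scope.

Lemma normc_cabs x : `|x| = (cabs x)%:C.
Proof. by rewrite /cabs; case: x => a b; rewrite normc_def. Qed.

Lemma cabs_def (a b : R) : cabs ((a +i* b) : Cx R) = Num.sqrt (a ^+ 2 + b ^+ 2).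
Proof. by rewrite /cabs normc_def. Qed.

Lemma cabs_ge0 x : 0 <= cabs x.
Proof. by rewrite -ler0c -normc_cabs. Qed.

Lemma cabs0 : cabs (0 : Cx R) = 0.
Proof. by rewrite /cabs normr0. Qed.

Lemma cabs1 : cabs (1 : Cx R) = 1.
Proof. by rewrite /cabs normr1. Qed.

Lemma cabs_eq0 x : (cabs x == 0) = (x == 0).
Proof. by rewrite -[RHS]normr_eq0 normc_cabs eq_complex /= eqxx andbT. Qed.

Lemma cabs_gt0 x : (0 < cabs x) = (x != 0).
Proof. by rewrite lt_def cabs_ge0 andbT cabs_eq0. Qed.

Lemma cabsM x y : cabs (x * y) = cabs x * cabs y.
Proof. by apply: complexI; rewrite rmorphM /= -!normc_cabs normrM. Qed.

Lemma cabsX x n : cabs (x ^+ n) = cabs x ^+ n.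
Proof. by apply: complexI; rewrite rmorphXn /= -!normc_cabs normrX. Qed.

Lemma cabsV x : cabs x^-1 = (cabs x)^-1.
Proof.
apply: complexI; rewrite -normc_cabs normfV normc_cabs.
by rewrite (fmorphV (real_complex R)).
Qed.

Lemma cabsN x : cabs (- x) = cabs x.
Proof. by rewrite /cabs normrN. Qed.

Lemma cabsB x y : cabs (x - y) = cabs (y - x).
Proof. by rewrite -cabsN opprB. Qed.

Lemma cabsD x y : cabs (x + y) <= cabs x + cabs y.
Proof. by rewrite -lecR rmorphD /= -!normc_cabs ler_normD. Qed.

Lemma cabs_real (a : R) : cabs (a%:C : Cx R) = `|a|.
Proof. by rewrite cabs_def expr0n addr0 sqrtr_sqr. Qed.

Lemma sqr_cabs x : cabs x ^+ 2 = complex.Re x ^+ 2 + complex.Im x ^+ 2.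
Proof. by case: x => a b; rewrite cabs_def sqr_sqrtr// addr_ge0 ?sqr_ge0. Qed.

Lemma ler_Re_cabs x : `|complex.Re x| <= cabs x.
Proof. by rewrite -lecR -normc_cabs; exact: normc_ge_Re. Qed.

Lemma ler_Im_cabs x : `|complex.Im x| <= cabs x.
Proof.
rewrite -(@ler_pXn2r _ 2)// ?nnegrE ?cabs_ge0// sqr_cabs real_normK ?num_real//.
by rewrite lerDr sqr_ge0.
Qed.

Lemma cabs_le_ReIm x : cabs x <= `|complex.Re x| + `|complex.Im x|.
Proof.
rewrite -(@ler_pXn2r _ 2)// ?nnegrE ?cabs_ge0 ?addr_ge0// sqr_cabs sqrrD.
by rewrite !real_normK ?num_real// lerD2r lerDl mulrn_wge0// mulr_ge0.
Qed.

Lemma ReD x y : complex.Re (x + y) = complex.Re x + complex.Re y.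
Proof. by case: x; case: y. Qed.

Lemma ReB x y : complex.Re (x - y) = complex.Re x - complex.Re y.
Proof. by case: x; case: y. Qed.

Lemma ImB x y : complex.Im (x - y) = complex.Im x - complex.Im y.
Proof. by case: x; case: y. Qed.

Lemma ReZ (a : R) x : complex.Re (a%:C * x) = a * complex.Re x.
Proof. by case: x => u v /=; rewrite mul0r subr0. Qed.

Lemma ReM x y : complex.Re (x * y) =
  complex.Re x * complex.Re y - complex.Im x * complex.Im y.
Proof. by case: x; case: y. Qed.

Lemma ImM x y : complex.Im (x * y) =
  complex.Re x * complex.Im y + complex.Im x * complex.Re y.
Proof. by case: x; case: y. Qed.

Lemma Re_sum (I : Type) (r : seq I) (P : pred I) (F : I -> Cx R) :
  complex.Re (\sum_(i <- r | P i) F i) = \sum_(i <- r | P i) complex.Re (F i).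
Proof. by elim/big_ind2 : _ => // x a y b <- <-; rewrite ReD. Qed.

Lemma gt0_complex (e : Cx R) : 0 < e -> 0 < complex.Re e /\ e = (complex.Re e)%:C.
Proof. by case: e => a b; rewrite ltcE /= => /andP[/eqP -> ?]. Qed.

(** Neighbourhoods in the plane are described here with real radii. *)
Lemma nbhs_cabsP z (P : set (Cx R)) :
  nbhs z P <-> exists2 d : R, 0 < d & forall y, cabs (y - z) < d -> P y.
Proof.
split.
  move=> /nbhs_ballP[e /= /gt0_complex[e0 ->]] eP; exists (complex.Re e) => // y yz.
  by apply: eP; rewrite -ball_normE /= distrC normc_cabs ltcR.
move=> [d d0 dP]; apply/nbhs_ballP; exists (d%:C); first by rewrite /= ltcR.
by move=> y; rewrite -ball_normE /= distrC normc_cabs ltcR; exact: dP.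
Qed.

(** Complex differentiability is handled through real first-order estimates, in
    both directions. *)
Lemma differentiable_eps (h : Cx R -> Cx R) z : differentiable h z ->
  exists d : Cx R, forall e : R, 0 < e -> exists2 r : R, 0 < r &
    forall s, cabs s < r -> cabs (h (z + s) - h z - d * s) <= e * cabs s.
Proof.
move=> /derivable1_diffP /derivable_nbhs hE; exists ('D_1 h z) => e e0.
have e0C : 0 < (e%:C : Cx R) by rewrite ltcR.
set o := (X in _ = _ + _ + X) in hE.
have /nbhs_cabsP[r r0 rP] := littleoP o e0C.
exists r => // s sr; have := rP s; rewrite subr0 => /(_ sr).
rewrite !normc_cabs -rmorphM /= lecR.
move=> H; have /(congr1 (fun g => g s)) /= := hE.
rewrite !fctE /= /GRing.scale /= mulr1 [s + z]addrC => ->.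
suff -> : h z + s * 'D_1 h z + o s - h z - 'D_1 h z * s = o s by [].
by move: (o s) => w; rewrite [s * _]mulrC; ring.
Qed.

Lemma eps_differentiable (h : Cx R -> Cx R) z (d : Cx R) :
  (forall e : R, 0 < e -> exists2 r : R, 0 < r &
    forall s, cabs s < r -> cabs (h (z + s) - h z - d * s) <= e * cabs s) ->
  differentiable h z.
Proof.
move=> H; apply/derivable1_diffP/cvg_ex; exists d.
apply/cvgrPdist_le => e /gt0_complex[e0 ->].
have [r r0 rP] := H _ e0.
apply/nbhs_cabsP; exists r => // s; rewrite subr0 => sr s0.
have -> : d - s^-1 *: ((h \o shift z) s%:A - h z) =
    - (s^-1 * (h (z + s) - h z - d * s)) :> Cx R.
  rewrite /= /GRing.scale /= mulr1 [s + z]addrC.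
  have -> : d = s^-1 * (d * s) :> Cx R by rewrite mulrCA mulVf// mulr1.
  by rewrite -mulrBr -[RHS]mulrN !opprB (mulrCA s^-1) mulVf// mulr1.
rewrite normrN normc_cabs lecR cabsM cabsV mulrC ler_pdivrMr ?cabs_gt0//.
exact: rP.
Qed.

Lemma holomorphic_lipschitz (h : Cx R -> Cx R) z : differentiable h z ->
  exists2 C : R, 0 < C & exists2 r : R, 0 < r &
    forall s, cabs s < r -> cabs (h (z + s) - h z) <= C * cabs s.
Proof.
move=> /differentiable_eps[d /(_ _ ltr01)[r r0 rP]].
exists (1 + cabs d); first by rewrite ltr_pwDl ?cabs_ge0.
exists r => // s sr; have := rP _ sr.
move=> H; rewrite mulrDl -cabsM -[X in cabs X](subrK (d * s)).
by rewrite (le_trans (cabsD _ _))// lerD2r.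
Qed.

End modulus.

(** * The complex exponential *)

Section complex_exponential.
Context (R : realType).
Implicit Types z : Cx R.
Local Open Scope complex_scope.

Definition cexp z : Cx R :=
  (expR (complex.Re z) * cos (complex.Im z)) +i*
  (expR (complex.Re z) * sin (complex.Im z)).

Lemma cexpD z w : cexp (z + w) = cexp z * cexp w.
Proof.
case: z => a b; case: w => c d; apply/eqP.
by rewrite /cexp eq_complex /= expRD cosD sinD; apply/andP; split; apply/eqP; ring.
Qed.

Lemma cexp0 : cexp 0 = 1.
Proof. by rewrite /cexp /= expR0 cos0 sin0 mulr0 mulr1. Qed.

Lemma cabs_cexp z : cabs (cexp z) = expR (complex.Re z).
Proof.
rewrite cabs_def !exprMn -mulrDr cos2Dsin2 mulr1 sqrtr_sqr.
by rewrite ger0_norm// expR_ge0.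
Qed.

Lemma cexp_neq0 z : cexp z != 0.
Proof. by rewrite -cabs_gt0 cabs_cexp expR_gt0. Qed.

Lemma cexp_period z : cexp (z + 0 +i* (pi *+ 2)) = cexp z.
Proof. by case: z => a b; rewrite /cexp /= addr0 cosD2pi sinD2pi. Qed.

Lemma cexpM_nat n z : cexp (n%:R * z) = cexp z ^+ n.
Proof.
elim: n => [|n IH]; first by rewrite mul0r cexp0.
by rewrite exprS -IH -cexpD -natr1 mulrDl mul1r addrC.
Qed.

Lemma is_derive_eps (g : R -> R) (x d : R) : is_derive x 1 g d ->
  forall e : R, 0 < e -> exists2 r : R, 0 < r &
    forall s, `|s| < r -> `|g (x + s) - g x - d * s| <= e * `|s|.
Proof.
move=> [+ <-] => /derivable_nbhs gE e e0.
set o := (X in _ = _ + _ + X) in gE.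
have /nbhs_ballP[r r0 rP] := littleoP o e0.
exists r => // s sr; have := rP s; rewrite -ball_normE /= sub0r normrN => /(_ sr) H.
have /(congr1 (fun g => g s)) /= := gE.
rewrite !fctE /= /GRing.scale /= mulr1 [s + x]addrC => ->.
suff -> : g x + s * 'D_1 g x + o s - g x - 'D_1 g x * s = o s by [].
by move: (o s) => w; ring.
Qed.

(** exp s = 1 + s + o(s), from the derivatives of expR, cos and sin at 0. *)
Lemma cexp_small (e : R) : 0 < e -> exists2 r : R, 0 < r &
  forall s : Cx R, cabs s < r -> cabs (cexp s - 1 - s) <= e * cabs s.
Proof.
move=> e0; pose e' := Num.min e 1 / 10.
have e'0 : 0 < e' by rewrite divr_gt0// lt_min e0 ltr01.
have e'1 : e' <= 1 / 10 by rewrite ler_pM2r// ge_min lexx orbT.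
have e'e : e' <= e / 10 by rewrite ler_pM2r// ge_min lexx.
have [r1 r10 H1] := @is_derive_eps expR 0 _ (is_derive_expR 0) _ e'0.
have [r2 r20 H2] := @is_derive_eps cos 0 _ (is_derive_cos 0) _ e'0.
have [r3 r30 H3] := @is_derive_eps sin 0 _ (is_derive_sin 0) _ e'0.
exists (Num.min (Num.min r1 r2) (Num.min r3 e')); first by rewrite !lt_min r10 r20 r30.
case=> x y; rewrite !lt_min => /andP[/andP[s1 s2] /andP[s3 s4]].
have xs := ler_Re_cabs (x +i* y : Cx R); have ys := ler_Im_cabs (x +i* y : Cx R).
rewrite /= in xs ys.
have {}H1 := H1 x (le_lt_trans xs s1).
have {}H2 := H2 y (le_lt_trans ys s2).
have {}H3 := H3 y (le_lt_trans ys s3).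
rewrite add0r expR0 mul1r in H1; rewrite add0r cos0 sin0 oppr0 mul0r subr0 in H2.
rewrite add0r sin0 cos0 subr0 mul1r in H3.
set s := (x +i* y : Cx R) in xs ys s1 s2 s3 s4 *.
pose u := (cos y +i* sin y : Cx R).
have u1 : cabs u = 1 by rewrite cabs_def cos2Dsin2 sqrtr1.
have H4 : cabs (u - 1 - (0 +i* y)) <= 2 * e' * cabs s.
  apply: (le_trans (cabs_le_ReIm _)); rewrite /= subr0 oppr0 addr0.
  by apply: (le_trans (lerD H2 H3)); move: ys e'0; nra.
have H5 : cabs (u - 1) <= 2 * cabs s.
  rewrite -[u - 1](subrK (0 +i* y : Cx R)) (le_trans (cabsD _ _))//.
  have : cabs (0 +i* y : Cx R) <= cabs s.
    by rewrite cabs_def expr0n add0r sqrtr_sqr.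
  have : 0 <= cabs s := cabs_ge0 _.
  by move: H4; nra.
(* Each summand vanishes to higher order than s, because |u| = 1. *)
have -> : cexp s - 1 - s =
    (expR x - 1 - x)%:C * u + x%:C * (u - 1) + (u - 1 - (0 +i* y)) :> Cx R.
  by apply/eqP; rewrite eq_complex /=; apply/andP; split; apply/eqP; ring.
apply: (le_trans (cabsD _ _)).
apply: (le_trans (lerD (cabsD _ _) (lexx _))).
rewrite !cabsM u1 mulr1 !cabs_real.
have : `|x| * cabs (u - 1) <= e' * (2 * cabs s).
  by apply: ler_pM => //; [exact: cabs_ge0|rewrite ltW// (le_lt_trans xs s4)].
have : 0 <= cabs s := cabs_ge0 _.
by move: H1 H4 xs e'e e'0; nra.
Qed.

Lemma differentiable_cexp z : differentiable cexp z.
Proof.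
apply: (@eps_differentiable _ _ _ (cexp z)) => e e0.
have K0 : 0 < cabs (cexp z) by rewrite cabs_gt0 cexp_neq0.
have [r r0 H] := cexp_small (divr_gt0 e0 K0).
exists r => // s /H {}H; rewrite cexpD.
have -> : cexp z * cexp s - cexp z - cexp z * s = cexp z * (cexp s - 1 - s) by ring.
by rewrite cabsM mulrC -ler_pdivlMr// mulrAC.
Qed.

End complex_exponential.

(** * Goursat's theorem on rectangles *)

Section goursat.
Context (R : realType).
Local Notation mu := (@lebesgue_measure R).

Lemma integrable_cts (f : R -> R) (a b : R) :
  (forall x, a <= x <= b -> {for x, continuous f}) ->
  mu.-integrable `[a, b] (EFin \o f).
Proof.
move=> cf; apply: continuous_compact_integrable; first exact: segment_compact.
apply: continuous_in_subspaceT => x; rewrite inE /= in_itv /= => xab.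
exact: cf.
Qed.

Lemma Rintegral_itv_cat (f : R -> R) (a c b : R) : a <= c -> c <= b ->
  (forall x, a <= x <= b -> {for x, continuous f}) ->
  (\int[mu]_(x in `[a, b]) f x =
   \int[mu]_(x in `[a, c]) f x + \int[mu]_(x in `[c, b]) f x)%R.
Proof.
move=> ac cb cf; apply/eqP; rewrite addrC -subr_eq; apply/eqP.
rewrite Rintegral_itvB ?bnd_simp//; last exact: integrable_cts.
rewrite Rintegral_itv_obnd_cbnd//.
apply: (integrableS _ _ _ (integrable_cts cf)) => //.
by apply: subset_itv; rewrite bnd_simp.
Qed.

Lemma Rintegral_itv_bound (f : R -> R) (a b k e : R) : a <= b ->
  (forall x, a <= x <= b -> {for x, continuous f}) ->
  (forall x, a <= x <= b -> `|f x - k| <= e) ->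
  `|\int[mu]_(x in `[a, b]) f x - k * (b - a)| <= e * (b - a).
Proof.
move=> ab cf fk.
have muab : fine (mu `[a, b]%classic) = b - a.
  rewrite lebesgue_measure_itv /= lte_fin; case: ltP => //= ba.
  by apply/esym/eqP; rewrite subr_eq0 eq_le ba ab.
have ik : mu.-integrable `[a, b] (EFin \o cst k).
  by apply: integrable_cts => x _; exact: cst_continuous.
have <- : \int[mu]_(x in `[a, b]) cst k x = k * (b - a).
  by rewrite Rintegral_cst// muab.
rewrite -RintegralB//; last exact: integrable_cts.
have cfk x : a <= x <= b -> {for x, continuous (fun x => f x - k)}.
  by move=> xab; apply: cvgB; [exact: cf|exact: cvg_cst].
have cnfk x : a <= x <= b -> {for x, continuous (fun x => `|f x - k|)}.
  by move=> xab; apply: cvg_norm; exact: cfk.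
have ifk : mu.-integrable `[a, b] (EFin \o (fun x => f x - cst k x)).
  exact: integrable_cts cfk.
apply: (le_trans (le_normr_Rintegral _ ifk)); first exact: measurable_itv.
have ie : mu.-integrable `[a, b] (EFin \o (fun=> e)).
  by apply: integrable_cts => x _; exact: cst_continuous.
rewrite -muab -Rintegral_cst//; apply: le_Rintegral => //.
exact: integrable_cts cnfk.
Qed.

(** The counterclockwise integral of V dx + U dy along the boundary of the
    rectangle [a, b] x [c, d]; for H = U + i V this is the imaginary part of the
    contour integral of H. *)
Definition circulation (U V : R -> R -> R) (a b c d : R) : R :=
  \int[mu]_(y in `[c, d]) (U b y - U a y) -
  \int[mu]_(x in `[a, b]) (V x d - V x c).

(** Differentiability of U and V at (p, q), together with the Cauchy-Riemann
    equation dU/dx = dV/dy that makes the 1-form V dx + U dy closed there. *)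
Definition conjugate_at (U V : R -> R -> R) (p q : R) : Prop :=
  exists A B C : R, forall e : R, 0 < e -> exists2 r : R, 0 < r &
    forall x y, `|x| < r -> `|y| < r ->
    `|U (p + x) (q + y) - U p q - A * x - B * y| <= e * (`|x| + `|y|) /\
    `|V (p + x) (q + y) - V p q - C * x - A * y| <= e * (`|x| + `|y|).

Lemma nested_limit (u : nat -> R) (w : R) : 0 <= w ->
  (forall n, u n <= u n.+1) ->
  (forall n, u n.+1 + w / 2 ^+ n.+1 <= u n + w / 2 ^+ n) ->
  exists p, forall n, u n <= p <= u n + w / 2 ^+ n.
Proof.
move=> w0 uS uwS.
have uhomo : {homo u : n m / (n <= m)%N >-> n <= m}.
  by apply: homo_leq => // ? ? ?; exact: le_trans.
have uwhomo n m : (n <= m)%N -> u m + w / 2 ^+ m <= u n + w / 2 ^+ n.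
  elim: m => [|m IH]; first by rewrite leqn0 => /eqP ->.
  rewrite leq_eqVlt => /orP[/eqP -> //|]; rewrite ltnS => /IH; exact: le_trans.
have uub n m : u m <= u n + w / 2 ^+ n.
  have [nm|/ltnW mn] := leqP n m.
    by apply: le_trans (uwhomo _ _ nm); rewrite lerDl divr_ge0// exprn_ge0.
  by apply: (le_trans (uhomo _ _ mn)); rewrite lerDl divr_ge0// exprn_ge0.
exists (sup (range u)) => n; apply/andP; split.
  apply: ub_le_sup; last by exists n.
  by exists (u 0 + w / 2 ^+ 0) => _ [m _ <-].
by apply: ge_sup; [exists (u 0), 0 | move=> _ [m _ <-]].
Qed.

Section rectangle.
Variables (U V : R -> R -> R) (a b c d : R).
Hypothesis cU : forall x y, a <= x <= b -> c <= y <= d -> {for y, continuous (U x)}.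
Hypothesis cV : forall x y, a <= x <= b -> c <= y <= d ->
  {for x, continuous (V ^~ y)}.

Let I := circulation U V.

Let cBU x x' c' d' : a <= x <= b -> a <= x' <= b -> c <= c' -> d' <= d ->
  forall y, c' <= y <= d' -> {for y, continuous (fun y => U x' y - U x y)}.
Proof.
move=> xab x'ab cc' d'd y /andP[cy yd].
have ycd : c <= y <= d by rewrite (le_trans cc')// (le_trans yd).
by apply: cvgB; exact: cU.
Qed.

Let cBV y y' a' b' : c <= y <= d -> c <= y' <= d -> a <= a' -> b' <= b ->
  forall x, a' <= x <= b' -> {for x, continuous (fun x => V x y' - V x y)}.
Proof.
move=> ycd y'cd aa' b'b x /andP[ax xb].
have xab : a <= x <= b by rewrite (le_trans aa')// (le_trans xb).
by apply: cvgB; [exact: (cV xab y'cd)|exact: (cV xab ycd)].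
Qed.

Lemma circulation_split_x a' b' c' d' m :
  a <= a' -> a' <= m -> m <= b' -> b' <= b -> c <= c' -> c' <= d' -> d' <= d ->
  I a' b' c' d' = I a' m c' d' + I m b' c' d'.
Proof.
move=> aa' a'm mb' b'b cc' c'd' d'd; rewrite /I /circulation.
have a'ab : a <= a' <= b by rewrite aa' (le_trans a'm)// (le_trans mb').
have mab : a <= m <= b by rewrite (le_trans aa')// (le_trans mb').
have b'ab : a <= b' <= b by rewrite b'b (le_trans aa')// (le_trans a'm).
have c'cd : c <= c' <= d by rewrite cc' (le_trans c'd').
have d'cd : c <= d' <= d by rewrite d'd (le_trans cc').
rewrite (@Rintegral_itv_cat _ a' m b')//; last exact: cBV.
have -> : \int[mu]_(y in `[c', d']) (U b' y - U a' y) =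
  \int[mu]_(y in `[c', d']) (U b' y - U m y) +
  \int[mu]_(y in `[c', d']) (U m y - U a' y).
  rewrite -RintegralD//; [|exact/integrable_cts/cBU|exact/integrable_cts/cBU].
  by apply: eq_Rintegral => y _ /=; rewrite addrA subrK.
ring.
Qed.

Lemma circulation_split_y a' b' c' d' m :
  c <= c' -> c' <= m -> m <= d' -> d' <= d -> a <= a' -> a' <= b' -> b' <= b ->
  I a' b' c' d' = I a' b' c' m + I a' b' m d'.
Proof.
move=> aa' a'm mb' b'b cc' c'd' d'd; rewrite /I /circulation.
have a'ab : c <= c' <= d by rewrite aa' (le_trans a'm)// (le_trans mb').
have mab : c <= m <= d by rewrite (le_trans aa')// (le_trans mb').
have b'ab : c <= d' <= d by rewrite b'b (le_trans aa')// (le_trans a'm).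
have c'cd : a <= a' <= b by rewrite cc' (le_trans c'd').
have d'cd : a <= b' <= b by rewrite d'd (le_trans cc').
rewrite (@Rintegral_itv_cat _ c' m d')//; last exact: cBU.
have -> : \int[mu]_(x in `[a', b']) (V x d' - V x c') =
  \int[mu]_(y in `[a', b']) (V y d' - V y m) +
  \int[mu]_(y in `[a', b']) (V y m - V y c').
  rewrite -RintegralD//; [|exact/integrable_cts/cBV|exact/integrable_cts/cBV].
  by apply: eq_Rintegral => y _ /=; rewrite addrA subrK.
ring.
Qed.

(** The linear parts of U and V contribute opposite circulations, so that only
    the remainders count: they are of size e times the perimeter. *)
Lemma circulation_small p q : conjugate_at U V p q ->
  forall e : R, 0 < e -> exists2 r : R, 0 < r &
  forall a' b' c' d', a <= a' -> b' <= b -> c <= c' -> d' <= d ->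
    a' <= p <= b' -> c' <= q <= d' -> b' - a' < r -> d' - c' < r ->
    `|I a' b' c' d'| <= e * ((b' - a') + (d' - c')) ^+ 2.
Proof.
move=> [A [B [C H]]] e e0; have e20 : 0 < e / 2 by rewrite divr_gt0.
have [r r0 {}H] := H _ e20; exists r => // a' b' c' d' aa' b'b cc' d'd.
move=> /andP[a'p pb'] /andP[c'q qd'] wr lr.
have a'b' := le_trans a'p pb'; have c'd' := le_trans c'q qd'.
have a'ab : a <= a' <= b by rewrite aa' (le_trans a'b').
have b'ab : a <= b' <= b by rewrite b'b (le_trans aa').
have c'cd : c <= c' <= d by rewrite cc' (le_trans c'd').
have d'cd : c <= d' <= d by rewrite d'd (le_trans cc').
set w := b' - a' in wr *; set l := d' - c' in lr *.
have w0 : 0 <= w by rewrite subr_ge0.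
have l0 : 0 <= l by rewrite subr_ge0.
have near x y : a' <= x <= b' -> c' <= y <= d' ->
    `|U x y - U p q - A * (x - p) - B * (y - q)| <= e / 2 * (w + l) /\
    `|V x y - V p q - C * (x - p) - A * (y - q)| <= e / 2 * (w + l).
  move=> /andP[a'x xb'] /andP[c'y yd'].
  have xw : `|x - p| <= w by rewrite ler_norml /w; lra.
  have yl : `|y - q| <= l by rewrite ler_norml /l; lra.
  have := H _ _ (le_lt_trans xw wr) (le_lt_trans yl lr).
  rewrite (addrC p) subrK (addrC q) subrK => -[H1 H2].
  have wl : e / 2 * (`|x - p| + `|y - q|) <= e / 2 * (w + l).
    by rewrite ler_pM2l// lerD.
  by split; [exact: le_trans H1 wl|exact: le_trans H2 wl].
have a'in : a' <= a' <= b' by rewrite lexx.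
have b'in : a' <= b' <= b' by rewrite lexx andbT.
have c'in : c' <= c' <= d' by rewrite lexx.
have d'in : c' <= d' <= d' by rewrite lexx andbT.
have HU : `|\int[mu]_(y in `[c', d']) (U b' y - U a' y) - A * w * l| <=
    e * (w + l) * l.
  apply: Rintegral_itv_bound => //; first exact: cBU.
  move=> y ycd.
  have [+ _] := near b' y b'in ycd.
  have [+ _] := near a' y a'in ycd.
  by rewrite !ler_norml /w; lra.
have HV : `|\int[mu]_(x in `[a', b']) (V x d' - V x c') - A * l * w| <=
    e * (w + l) * w.
  apply: Rintegral_itv_bound => //; first exact: cBV.
  move=> x xab.
  have [_ +] := near x d' xab d'in.
  have [_ +] := near x c' xab c'in.
  by rewrite !ler_norml /l; lra.
rewrite /I /circulation; move: HU HV; rewrite !ler_norml; nra.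
Qed.

Hypothesis diffUV : forall p q, a <= p <= b -> c <= q <= d -> conjugate_at U V p q.

(** One of the four quarters carries at least a quarter of the circulation. *)
Lemma bisection x y wm lm k : 0 <= wm -> 0 <= lm -> a <= x ->
  x + (wm + wm) <= b -> c <= y -> y + (lm + lm) <= d ->
  4 * k <= `|I x (x + (wm + wm)) y (y + (lm + lm))| ->
  exists x' y', [/\ x' = x \/ x' = x + wm, y' = y \/ y' = y + lm &
    k <= `|I x' (x' + wm) y' (y' + lm)|].
Proof.
move=> wm0 lm0 ax xb cy yd; rewrite !addrA in xb yd *.
have xx : x <= x + wm by rewrite lerDl.
have xx' : x + wm <= x + wm + wm by rewrite lerDl.
have yy : y <= y + lm by rewrite lerDl.
have yy' : y + lm <= y + lm + lm by rewrite lerDl.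
have IE : I x (x + wm + wm) y (y + lm + lm) =
    I x (x + wm) y (y + lm) + I x (x + wm) (y + lm) (y + lm + lm) +
    (I (x + wm) (x + wm + wm) y (y + lm) +
     I (x + wm) (x + wm + wm) (y + lm) (y + lm + lm)).
  rewrite (@circulation_split_x _ _ _ _ (x + wm))//;
    last by rewrite (le_trans yy).
  rewrite (@circulation_split_y _ _ _ _ (y + lm))//; last by rewrite (le_trans xx').
  by rewrite (@circulation_split_y (x + wm) _ _ _ (y + lm))// (le_trans ax).
rewrite IE => KI.
have [k1|k1] := lerP k `|I x (x + wm) y (y + lm)|.
  by exists x, y; split => //; left.
have [k2|k2] := lerP k `|I x (x + wm) (y + lm) (y + lm + lm)|.
  by exists x, (y + lm); split => //; [left|right].
have [k3|k3] := lerP k `|I (x + wm) (x + wm + wm) y (y + lm)|.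
  by exists (x + wm), y; split => //; [right|left].
have [k4|k4] := lerP k `|I (x + wm) (x + wm + wm) (y + lm) (y + lm + lm)|.
  by exists (x + wm), (y + lm); split => //; right.
suff : 4 * k < 4 * k by rewrite ltxx.
apply: (le_lt_trans KI); apply: (le_lt_trans (ler_normD _ _)).
apply: (le_lt_trans (lerD (ler_normD _ _) (ler_normD _ _))).
by move: k1 k2 k3 k4; lra.
Qed.

(** Goursat's bisection: a nonzero circulation would persist, relatively to the
    area, on nested rectangles shrinking to a point. *)
Theorem circulation_eq0 : a <= b -> c <= d -> I a b c d = 0.
Proof.
move=> ab cd; apply/eqP; apply: contrapT => /negP.
rewrite -normr_gt0; set K := `|I a b c d| => K0.
pose w n := (b - a) / 2 ^+ n; pose l n := (d - c) / 2 ^+ n.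
have w0 n : 0 <= w n by rewrite divr_ge0 ?subr_ge0// exprn_ge0.
have l0 n : 0 <= l n by rewrite divr_ge0 ?subr_ge0// exprn_ge0.
have wS n : w n = w n.+1 + w n.+1.
  by rewrite /w exprS invfM; field; rewrite ?expf_neq0.
have lS n : l n = l n.+1 + l n.+1.
  by rewrite /l exprS invfM; field; rewrite ?expf_neq0.
pose P n (z : R * R) := [/\ a <= z.1, z.1 + w n <= b, c <= z.2, z.2 + l n <= d &
  K / 4 ^+ n <= `|I z.1 (z.1 + w n) z.2 (z.2 + l n)|].
have step n z : exists z', P n z ->
    [/\ P n.+1 z', z.1 <= z'.1, z'.1 + w n.+1 <= z.1 + w n,
      z.2 <= z'.2 & z'.2 + l n.+1 <= z.2 + l n].
  have [[az zb cz zd KI]|nP] := pselect (P n z); last by exists z.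
  set x := z.1 in az zb KI *; set y := z.2 in cz zd KI *.
  have KE : K / 4 ^+ n = 4 * (K / 4 ^+ n.+1).
    by rewrite exprS invfM; field; rewrite ?expf_neq0.
  rewrite wS lS KE in zb zd KI.
  have [x' [y' [xE yE KI']]] := bisection (w0 n.+1) (l0 n.+1) az zb cz zd KI.
  have wn0 := w0 n.+1; have ln0 := l0 n.+1.
  exists (x', y') => _; rewrite /P /= (wS n) (lS n); move: wn0 ln0 xE yE KI' az zb cz zd.
  move: (w n.+1) (l n.+1) => wm lm.
  by move=> ? ? [] -> [] -> ? ? ? ? ?; split; try split; rewrite //; lra.
have [F FP] := choice (fun nz => step nz.1 nz.2).
pose z := fix z n := if n is m.+1 then F (m, z m) else (a, c).
have E (u u' : R) : u + (u' - u) / 2 ^+ 0 = u'.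
  by rewrite expr0 divr1 addrC subrK.
have Pz n : P n (z n).
  elim: n => [|n IH]; last by case: (FP (n, z n) IH).
  by split; rewrite /= /w /l ?E // expr0 divr1.
have [p pP] : exists p, forall n, (z n).1 <= p <= (z n).1 + w n.
  by apply: nested_limit => [|n|n]; rewrite ?subr_ge0//;
    case: (FP (n, z n) (Pz n)).
have [q qP] : exists q, forall n, (z n).2 <= q <= (z n).2 + l n.
  by apply: nested_limit => [|n|n]; rewrite ?subr_ge0//;
    case: (FP (n, z n) (Pz n)).
have pab : a <= p <= b.
  by have := pP 0; rewrite /= /w E.
have qcd : c <= q <= d.
  by have := qP 0; rewrite /= /l E.
set S := (b - a) + (d - c).
have S0 : 0 <= S by rewrite addr_ge0 ?subr_ge0.
(* On the n-th rectangle the circulation is at least K / 4 ^ n by construction,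
   and at most e S ^ 2 / 4 ^ n near the limit point: this e is too small. *)
have e0 : 0 < K / (S ^+ 2 + 1) / 2.
  by rewrite !divr_gt0// ltr_pwDr// sqr_ge0.
have [r r0 H] := circulation_small (diffUV pab qcd) e0.
have [n nr] : exists n, S / 2 ^+ n < r.
  have : (fun n => S * (2^-1) ^+ n) @ \oo --> S * 0.
    apply: cvgM; first exact: cvg_cst.
    by apply: cvg_expr; rewrite ger0_norm ?invf_lt1 ?ltr1n// invr_ge0.
  rewrite mulr0 => /cvgrPdist_lt/(_ _ r0)[N _ NP]; exists N.
  have := NP N (leqnn N); rewrite sub0r normrN exprVn.
  by apply: le_lt_trans; exact: ler_norm.
have [az zb cz zd KI] := Pz n.
have SE : w n + l n = S / 2 ^+ n by rewrite /w /l -mulrDl.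
have := H _ _ _ _ az zb cz zd (pP n) (qP n).
have -> : (z n).1 + w n - (z n).1 = w n by rewrite addrC addKr.
have -> : (z n).2 + l n - (z n).2 = l n by rewrite addrC addKr.
have wr : w n < r by move: (l0 n); lra.
have lr : l n < r by move: (w0 n); lra.
move=> /(_ wr lr); rewrite SE => /(le_trans KI).
have -> : (S / 2 ^+ n) ^+ 2 = S ^+ 2 / 4 ^+ n.
  by rewrite expr_div_n -exprM mulnC exprM; congr (_ / (_ ^+ _)); rewrite expr2 -natrM.
rewrite mulrA ler_pM2r ?invr_gt0 ?exprn_gt0//.
rewrite mulrAC -mulrA => KS.
have : K * (S ^+ 2 / (S ^+ 2 + 1)) / 2 < K.
  have s0 := sqr_ge0 S.
  have : S ^+ 2 / (S ^+ 2 + 1) <= 1 by rewrite ler_pdivrMr; lra.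
  move: K0; nra.
by move: KS; lra.
Qed.

End rectangle.
End goursat.

(** * The maximum principle at the center of a disc *)

Section maximum_principle.
Context (R : realType).
Local Notation mu := (@lebesgue_measure R).
Local Open Scope complex_scope.

Lemma cplxD (a b c d : R) : (a +i* b : Cx R) + (c +i* d : Cx R) = (a + c) +i* (b + d).
Proof. by []. Qed.

Lemma lipschitz_continuous_at (f : R -> R) (x C r : R) : 0 < C -> 0 < r ->
  (forall s, `|s| < r -> `|f (x + s) - f x| <= C * `|s|) -> {for x, continuous f}.
Proof.
move=> C0 r0 H; apply/cvgrPdist_lt => e e0; apply/nbhs_ballP.
exists (Num.min r (e / C)); first by rewrite /= lt_min r0 divr_gt0.
move=> y; rewrite /ball /= lt_min distrC => /andP[yr ye].
have := H (y - x) yr; rewrite (addrC x) subrK distrC => /le_lt_trans; apply.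
by rewrite mulrC -ltr_pdivlMr.
Qed.

Lemma conjugate_parts (H : Cx R -> Cx R) (p q : R) : differentiable H (p +i* q : Cx R) ->
  conjugate_at (fun x y => complex.Re (H (x +i* y)))
               (fun x y => complex.Im (H (x +i* y))) p q.
Proof.
move=> /differentiable_eps[d dP].
exists (complex.Re d), (- complex.Im d), (complex.Im d) => e /dP[r r0 {}dP].
exists (r / 2); first by rewrite divr_gt0.
move=> x y xr yr; set s := (x +i* y : Cx R).
have xy : cabs s <= `|x| + `|y| := cabs_le_ReIm _.
have sr : cabs s < r by apply: (le_lt_trans xy); lra.
have e0 : 0 <= e.
  rewrite leNgt; apply/negP => e0; have r2 : cabs ((r / 2)%:C : Cx R) < r.
    by rewrite cabs_real ger0_norm ?divr_ge0 ?ltW//; lra.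
  have := dP _ r2; rewrite cabs_real; have := cabs_ge0 (H ((p +i* q : Cx R) + (r / 2)%:C) - H (p +i* q) - d * (r / 2)%:C).
  have : 0 < `|r / 2| by rewrite normr_gt0; lra.
  nra.
have {}dP : cabs (H ((p +i* q : Cx R) + s) - H (p +i* q) - d * s) <= e * (`|x| + `|y|).
  by apply: (le_trans (dP _ sr)); exact: ler_wpM2l.
have -> : (p + x) +i* (q + y) = (p +i* q : Cx R) + s :> Cx R by [].
split.
  apply: le_trans dP; apply: le_trans (ler_Re_cabs _).
  by rewrite !ReB ReM /=; rewrite le_eqVlt; apply/orP; left; apply/eqP; congr (Num.norm _); ring.
apply: le_trans dP; apply: le_trans (ler_Im_cabs _).
by rewrite !ImB ImM /=; rewrite le_eqVlt; apply/orP; left; apply/eqP; congr (Num.norm _); ring.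
Qed.

Lemma continuous_parts (H : Cx R -> Cx R) (p q : R) : differentiable H (p +i* q : Cx R) ->
  {for q, continuous (fun y => complex.Re (H (p +i* y)))} /\
  {for p, continuous (fun x => complex.Im (H (x +i* q)))}.
Proof.
move=> /holomorphic_lipschitz[C C0 [r r0 HC]]; split;
  apply: (lipschitz_continuous_at C0 r0) => s sr.
  rewrite -ReB (le_trans (ler_Re_cabs _))//.
  have := HC (0 +i* s); rewrite cabs_def expr0n add0r sqrtr_sqr => /(_ sr).
  have <- : (p +i* q : Cx R) + (0 +i* s) = p +i* (q + s) by rewrite cplxD addr0.
  by [].
rewrite -ImB (le_trans (ler_Im_cabs _))//.
have := HC (s%:C); rewrite cabs_real => /(_ sr).
have <- : (p +i* q : Cx R) + s%:C = (p + s) +i* q by rewrite cplxD addr0.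
by [].
Qed.

(** The mean over the circle of radius exp x of the real part of a rotated copy
    of h does not depend on x, because exp is 2 pi i-periodic; as x decreases it
    tends to the modulus of h at the center. *)
Theorem maximum_at_center (h : Cx R -> Cx R) (M : R) :
  (forall t, cabs t <= 1 -> differentiable h t) ->
  (forall t, cabs t = 1 -> cabs (h t) <= M) ->
  cabs (h 0) <= M.
Proof.
move=> dh hM; rewrite leNgt; apply/negP => Mh.
have h0 : 0 < cabs (h 0).
  by apply: le_lt_trans Mh; apply: le_trans (hM 1 (cabs1 R)); exact: cabs_ge0.
(* The rotation c makes c * h 0 equal to the modulus of h 0. *)
pose c : Cx R := (cabs (h 0))%:C / h 0.
have c1 : cabs c = 1.
  by rewrite cabsM cabsV cabs_real ger0_norm ?cabs_ge0// divff// gt_eqF.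
have ch0 : c * h 0 = (cabs (h 0))%:C by rewrite mulfVK// -cabs_gt0.
pose H z := c * h (cexp z).
pose U x y := complex.Re (H (x +i* y)); pose V x y := complex.Im (H (x +i* y)).
have dH x y : x <= 0 -> differentiable H (x +i* y : Cx R).
  move=> x0; apply: differentiableM; first exact: differentiable_cst.
  apply: differentiable_comp; first exact: differentiable_cexp.
  by apply: dh; rewrite cabs_cexp /= -expR0 ler_expR.
pose e := (cabs (h 0) - M) / 2.
have e0 : 0 < e by rewrite divr_gt0 ?subr_gt0.
have [C C0 [r r0 hC]] := holomorphic_lipschitz (dh 0 (eq_ind_r (fun x => x <= 1) ler01 (cabs0 R))).
(* On the circle of radius d, the function c * h is within e of its value at the
   center. *)
pose d := Num.min 1 (Num.min r (e / C)) / 2.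
have d0 : 0 < d by rewrite divr_gt0// !lt_min ltr01 r0 divr_gt0.
have dd : d < Num.min 1 (Num.min r (e / C)).
  by rewrite /d; have : 0 < Num.min 1 (Num.min r (e / C)); [rewrite !lt_min ltr01 r0 divr_gt0|lra].
move: dd; rewrite !lt_min => /and3P[d1 dr de].
pose a := ln d.
have a0 : a <= 0 by rewrite ln_le0// ltW.
have pi2 : 0 <= pi *+ 2 :> R by rewrite mulrn_wge0// pi_ge0.
have : circulation U V a 0 0 (pi *+ 2) = 0.
  apply: circulation_eq0; [| | |exact: a0|exact: pi2].
  - by move=> x y /andP[_ x0] _; case: (continuous_parts (dH x y x0)).
  - by move=> x y /andP[_ x0] _; case: (continuous_parts (dH x y x0)).
  - by move=> x y /andP[_ x0] _; apply: conjugate_parts; exact: dH.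
rewrite /circulation.
have -> : \int[mu]_(x in `[a, 0]) (V x (pi *+ 2) - V x 0) = 0.
  transitivity (\int[mu]_(x in `[a, 0]) (cst 0 : R -> R) x); last first.
    by rewrite Rintegral_cst// mul0r.
  apply: eq_Rintegral => x _; rewrite /V /H.
  have -> : x +i* (pi *+ 2) = (x +i* 0 : Cx R) + 0 +i* (pi *+ 2).
    by rewrite cplxD addr0 add0r.
  by rewrite cexp_period subrr.
rewrite subr0 => I0.
have : \int[mu]_(y in `[0%R, pi *+ 2]) (U 0 y - U a y) <=
       \int[mu]_(y in `[0%R, pi *+ 2]) (cst (- e)) y.
  apply: le_Rintegral => //.
  - apply: integrable_cts => y _; apply: cvgB.
      by case: (continuous_parts (dH 0 y (lexx _))).
    by case: (continuous_parts (dH a y a0)).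
  - by apply: integrable_cts => y _; exact: cst_continuous.
  move=> y _.
  have U0 : U 0 y <= M.
    rewrite (le_trans (ler_norm _))// (le_trans (ler_Re_cabs _))//.
    by rewrite cabsM c1 mul1r hM// cabs_cexp /= expR0.
  have Ua : `|U a y - cabs (h 0)| <= e.
    have -> : cabs (h 0) = complex.Re (c * h 0) by rewrite ch0.
    rewrite -ReB -mulrBr (le_trans (ler_Re_cabs _))// cabsM c1 mul1r.
    have := hC (cexp (a +i* y)); rewrite add0r cabs_cexp /= lnK ?posrE// => /(_ dr).
    by move=> /le_trans; apply; rewrite mulrC -ler_pdivlMr// ltW.
  by move: Ua; rewrite ler_norml /e /=; lra.
rewrite I0 Rintegral_cst//= lebesgue_measure_itv /= lte_fin.
have pi20 : 0 < pi *+ 2 :> R by rewrite pmulrn_lgt0// pi_gt0.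
rewrite pi20 /= subr0; nra.
Qed.

End maximum_principle.

(** * The mean of ln |h| over roots of unity *)

Section poisson.
Context (R : realType).
Local Open Scope complex_scope.

Definition root_of_unity (N : nat) : Cx R := cexp (0 +i* (pi *+ 2 / N%:R)).

Lemma root_of_unityX N k :
  root_of_unity N ^+ k = cexp (0 +i* (pi *+ 2 * (k%:R / N%:R))).
Proof.
rewrite /root_of_unity -cexpM_nat; congr cexp.
have -> : k%:R = (k%:R : R)%:C :> Cx R by rewrite rmorph_nat.
by apply/eqP; rewrite eq_complex /=; apply/andP; split; apply/eqP; ring.
Qed.

Lemma root_of_unityN N : (0 < N)%N -> root_of_unity N ^+ N = 1.
Proof.
move=> N0; rewrite root_of_unityX divff ?pnatr_eq0 ?gtn_eqF// mulr1.
by rewrite -[X in cexp X]add0r cexp_period cexp0.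
Qed.

Lemma root_of_unity_neq1 N k : (0 < k < N)%N -> root_of_unity N ^+ k != 1.
Proof.
move=> /andP[k0 kN]; rewrite root_of_unityX.
have N0 : 0 < N%:R :> R by rewrite ltr0n (leq_trans _ kN).
set x := k%:R / N%:R.
have x0 : 0 < x by rewrite divr_gt0// ltr0n.
have x1 : x < 1 by rewrite ltr_pdivrMr// mul1r ltr_nat.
have -> : pi *+ 2 * x = (pi * x) *+ 2 by rewrite mulrnAl.
apply/eqP => /(congr1 (@complex.Re R)) /=; rewrite expR0 mul1r cos_mulr2n.
have p0 := pi_gt0 R.
have : 0 < sin (pi * x).
  by rewrite sin_gt0_pi// mulr_gt0//= -[ltRHS]mulr1 ltr_pM2l.
have := cos2Dsin2 (pi * x); nra.
Qed.

Lemma cabs_root_of_unity N k : cabs (root_of_unity N ^+ k) = 1.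
Proof. by rewrite root_of_unityX cabs_cexp /= expR0. Qed.

Lemma sum_root_of_unityX N j : (0 < j < N)%N ->
  \sum_(k < N) (root_of_unity N ^+ k) ^+ j = 0.
Proof.
move=> jN; have N0 : (0 < N)%N by case/andP: jN => j0; exact: leq_ltn_trans.
have := subrX1 (root_of_unity N ^+ j) N.
rewrite -exprM mulnC exprM root_of_unityN// expr1n subrr => /esym/eqP.
rewrite mulf_eq0 subr_eq0 (negbTE (root_of_unity_neq1 jN)) /= => /eqP H.
by rewrite -[RHS]H; apply: eq_bigr => k _; rewrite -!exprM mulnC.
Qed.

(** Only the powers of s that are multiples of N survive in the geometric
    expansions of the summands. *)
Lemma sum_schwarz_kernel N (s : Cx R) : (0 < N)%N -> cabs s < 1 ->
  \sum_(k < N) (root_of_unity N ^+ k + s) / (root_of_unity N ^+ k - s) =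
  N%:R * ((1 + s ^+ N) / (1 - s ^+ N)).
Proof.
move=> N0 s1; set a := fun k : 'I_N => root_of_unity N ^+ k.
have aN k : a k ^+ N = 1.
  by rewrite /a -exprM mulnC exprM root_of_unityN// expr1n.
have as0 k : a k - s != 0.
  rewrite subr_eq0; apply/eqP => /(congr1 (@cabs R)).
  by rewrite cabs_root_of_unity => sE; rewrite -sE ltxx in s1.
have sN0 : 1 - s ^+ N != 0.
  rewrite subr_eq0; apply/eqP => /(congr1 (@cabs R)); rewrite cabs1 cabsX => sE.
  have : cabs s ^+ N < 1 by rewrite exprn_ilt1 ?cabs_ge0// -lt0n.
  by rewrite -sE ltxx.
have H k : a k / (a k - s) = (1 - s ^+ N)^-1 * \sum_(j < N) a k ^+ (N - j) * s ^+ j.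
  apply: (mulfI sN0); rewrite mulVKf//.
  rewrite -{1}(aN k) subrXX; set Q := \sum_(i < N) _.
  have -> : (a k - s) * Q * (a k / (a k - s)) = a k * Q by field; exact: as0.
  rewrite /Q big_distrr /=; apply: eq_bigr => j _.
  by rewrite mulrA -exprS -subSn ?prednK// -ltnS prednK.
have H2 : \sum_(k < N) a k / (a k - s) = (1 - s ^+ N)^-1 * N%:R.
  rewrite (eq_bigr _ (fun k _ => H k)) -big_distrr /=; congr (_ * _).
  rewrite exchange_big /= (bigD1 (Ordinal N0)) //= [X in _ + X]big1 ?addr0.
    under eq_bigr do rewrite subn0 expr0 mulr1 aN.
    by rewrite sumr_const card_ord.
  move=> j j0; rewrite -big_distrl /= sum_root_of_unityX ?mul0r//.
  have j0' : (0 < j)%N by rewrite lt0n; apply: contra j0 => /eqP jE; apply/eqP/val_inj.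
  by rewrite subn_gt0 ltn_ord /= ltn_subrL j0' N0.
have K k : (a k + s) / (a k - s) = 2 * (a k / (a k - s)) - 1.
  by field.
rewrite (eq_bigr _ (fun k _ => K k)) big_split /= -big_distrr /= H2.
rewrite sumr_const card_ord -mulr_natl.
by field.
Qed.

(** The real part of the Schwarz kernel is the Poisson kernel. *)
Lemma Re_schwarz_kernel (a s : Cx R) : cabs a = 1 -> a - s != 0 ->
  complex.Re ((a + s) / (a - s)) = (1 - cabs s ^+ 2) / cabs (a - s) ^+ 2.
Proof.
move=> a1 as0.
have n0 : cabs (a - s) ^+ 2 != 0 by rewrite expf_eq0 /= cabs_eq0.
have : complex.Re a ^+ 2 + complex.Im a ^+ 2 = 1 by rewrite -sqr_cabs a1 expr1n.
move: n0; rewrite !sqr_cabs; clear as0 a1; case: a => a b; case: s => c d /=.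
move=> n0 ab1; rewrite -ab1; field.
exact: n0.
Qed.

Lemma Re_near1 (z : Cx R) : cabs z <= 1 / 4 ->
  `|complex.Re ((1 + z) / (1 - z)) - 1| <= 4 * cabs z.
Proof.
move=> z4; have z0 := cabs_ge0 z.
have d0 : 3 / 4 <= cabs (1 - z).
  have := cabsD (1 - z) z; rewrite subrK cabs1; lra.
have n0 : 1 - z != 0 by rewrite -cabs_gt0; lra.
have -> : complex.Re ((1 + z) / (1 - z)) - 1 = complex.Re (2 * z / (1 - z)).
  have <- : (1 + z) / (1 - z) - 1 = 2 * z / (1 - z) by field.
  by rewrite ReB.
apply: (le_trans (ler_Re_cabs _)); rewrite cabsM cabsV ler_pdivrMr; last lra.
rewrite cabsM.
have -> : cabs (2 : Cx R) = 2.
  have -> : (2 : Cx R) = (2 : R)%:C by rewrite rmorph_nat.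
  by rewrite cabs_real ger0_norm.
nra.
Qed.

Lemma pow_lt_eps (q e : R) : 0 < q < 1 -> 0 < e -> exists2 N, (0 < N)%N & q ^+ N <= e.
Proof.
move=> /andP[q0 q1] e0.
have : (fun n => q ^+ n) @ \oo --> (0 : R) by apply: cvg_expr; rewrite gtr0_norm.
move=> /cvgrPdist_lt/(_ _ e0)[N _ NP]; exists N.+1 => //.
have := NP N.+1 (leqnSn N); rewrite sub0r normrN => /ltW.
by rewrite ger0_norm// exprn_ge0// ltW.
Qed.

Lemma differentiable_mulC (c t : Cx R) : differentiable (fun u : Cx R => c * u) t.
Proof.
by apply: differentiableM; [exact: differentiable_cst|exact: ex_diff].
Qed.

(** The comparison function p is the Poisson integral of psi for the point
    masses 1/N at the N-th roots of unity, with its argument contracted by rho: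
    on the circle its real part is almost psi, at the center it is the mean of
    psi over the roots. The maximum principle is applied to h exp(-p). *)
Theorem log_submean_roots (e del M : R) : 0 < e -> 0 < del -> 0 <= M ->
  exists2 N, (0 < N)%N & forall (h : Cx R -> Cx R) (psi : Cx R -> R),
    (forall t, cabs t <= 1 -> differentiable h t) ->
    (forall t, cabs t = 1 -> `|psi t| <= M) ->
    (forall t t', cabs t = 1 -> cabs t' = 1 -> cabs (t' - t) < del ->
      `|psi t' - psi t| <= e) ->
    (forall t, cabs t = 1 -> cabs (h t) <= expR (psi t)) ->
    cabs (h 0) <= expR (N%:R^-1 * \sum_(k < N) psi (root_of_unity N ^+ k) + 4 * e).
Proof.
move=> e0 del0 M0.
(* g makes the Poisson kernel at most e / (2 M) at distance del from its pole, and
   N then makes rho ^ N so small that the kernels average to 1 up to e / M. *)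
pose g := Num.min (1 / 2) (Num.min (del / 2) (e * del ^+ 2 / (16 * (M + 1)))).
have M1 : 0 < M + 1 by lra.
have g0 : 0 < g by rewrite !lt_min !divr_gt0// ?mulr_gt0// exprn_gt0.
have g12 : g <= 1 / 2 by rewrite ge_min lexx.
have gdel : g <= del / 2 by rewrite !ge_min lexx orbT.
have gM : g * (16 * (M + 1)) <= e * del ^+ 2.
  by rewrite -ler_pdivlMr ?mulr_gt0// !ge_min lexx !orbT.
pose rho := 1 - g.
have rho01 : 0 < rho < 1 by rewrite /rho; lra.
have rho0 : 0 <= rho by case/andP: rho01 => /ltW.
have [N N0 qN] : exists2 N, (0 < N)%N & rho ^+ N <= Num.min (1 / 4) (e / (4 * (M + 1))).
  by apply: pow_lt_eps => //; rewrite lt_min !divr_gt0// mulr_gt0.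
move: qN; rewrite le_min => /andP[q4 qM].
rewrite ler_pdivlMr ?mulr_gt0// in qM.
exists N => // h psi dh psiM psie hpsi.
pose a (k : 'I_N) := root_of_unity N ^+ k.
have a1 k : cabs (a k) = 1 := cabs_root_of_unity N k.
have Ninv0 : 0 < N%:R^-1 :> R by rewrite invr_gt0 ltr0n.
pose S (k : 'I_N) (t : Cx R) : Cx R := (a k + rho%:C * t) / (a k - rho%:C * t).
pose p (t : Cx R) : Cx R := \sum_(k < N) (N%:R^-1 * psi (a k))%:C * S k t.
have rt (t : Cx R) : cabs t <= 1 -> cabs (rho%:C * t) < 1.
  rewrite cabsM cabs_real ger0_norm// => t1; have := cabs_ge0 t.
  by case/andP: rho01 => ? ?; nra.
have den k (t : Cx R) : cabs t <= 1 -> a k - rho%:C * t != 0.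
  move=> /rt t1; rewrite subr_eq0; apply/eqP => /(congr1 (@cabs R)).
  by rewrite a1 => tE; rewrite -tE ltxx in t1.
have Rep t : complex.Re (p t) = N%:R^-1 * \sum_(k < N) psi (a k) * complex.Re (S k t).
  rewrite /p Re_sum big_distrr /=; apply: eq_bigr => k _.
  by rewrite ReZ mulrA.
have p0 : complex.Re (p 0) = N%:R^-1 * \sum_(k < N) psi (a k).
  rewrite Rep; congr (_ * _); apply: eq_bigr => k _.
  rewrite /S mulr0 addr0 subr0 divff /= ?mulr1//.
  by rewrite -cabs_gt0 a1.
have dp t : cabs t <= 1 -> differentiable p t.
  move=> t1; have -> : p = \sum_(k < N) (fun t => (N%:R^-1 * psi (a k))%:C * S k t).
    by apply/funext => u; rewrite fct_sumE.
  apply: differentiable_sum => k; apply: differentiableM.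
    exact: differentiable_cst.
  have dr := differentiable_mulC rho%:C t.
  apply: differentiableM.
    by apply: differentiableD => //; exact: differentiable_cst.
  apply: differentiableV; last exact: den.
  by apply: differentiableB => //; exact: differentiable_cst.
pose G t := h t * cexp (- p t).
have GM : cabs (G 0) <= expR (4 * e).
  apply: maximum_at_center => t t1.
    apply: differentiableM; first exact: dh.
    apply: (@differentiable_comp _ _ _ _ (- p)).
      by apply: differentiableN; exact: dp.
    exact: differentiable_cexp.
  have t1' : cabs t <= 1 by rewrite t1.
  rewrite /G cabsM cabs_cexp.
  have -> : complex.Re (- p t) = - complex.Re (p t) by case: (p t).
  apply: (@le_trans _ _ (expR (psi t) * expR (- complex.Re (p t)))).
    by rewrite ler_pM2r ?expR_gt0// hpsi.
  rewrite -expRD ler_expR.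
  pose P k := complex.Re (S k t).
  have PE k : P k = (1 - rho ^+ 2) / cabs (a k - rho%:C * t) ^+ 2.
    by rewrite /P Re_schwarz_kernel ?den// cabsM cabs_real t1 mulr1 ger0_norm.
  have r20 : 0 <= 1 - rho ^+ 2 by rewrite /rho; nra.
  have P0 k : 0 <= P k by rewrite PE divr_ge0// sqr_ge0.
  pose T := N%:R^-1 * \sum_(k < N) P k.
  have NT : N%:R^-1 * N%:R = 1 :> R by rewrite mulVf// pnatr_eq0 gtn_eqF.
  have T1 : `|T - 1| <= 4 * rho ^+ N.
    have -> : T = complex.Re ((1 + (rho%:C * t) ^+ N) / (1 - (rho%:C * t) ^+ N)).
      rewrite /T -Re_sum sum_schwarz_kernel ?rt//.
      have -> : N%:R = (N%:R : R)%:C :> Cx R by rewrite rmorph_nat.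
      by rewrite ReZ mulrA NT mul1r.
    have := @Re_near1 ((rho%:C * t) ^+ N).
    by rewrite cabsX cabsM cabs_real t1 mulr1 (ger0_norm rho0); exact.
  have T2 : T <= 2 by move: T1; rewrite ler_norml; lra.
  have term k : - e * P k - e <= (psi (a k) - psi t) * P k.
    have [near|far] := ltP (cabs (a k - t)) del.
      have := psie t (a k) t1 (a1 k) near; have := P0 k.
      rewrite ler_norml => ? /andP[? ?]; nra.
    have d2 : del / 2 <= cabs (a k - rho%:C * t).
      have := cabsD (a k - rho%:C * t) ((rho - 1)%:C * t).
      have -> : a k - rho%:C * t + (rho - 1)%:C * t = a k - t.
        have aux (x y z : Cx R) : x - y * z + (y - 1) * z = x - z by ring.
        have -> : (rho - 1)%:C = rho%:C - 1 :> Cx R.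
          by apply/eqP; rewrite eq_complex /= oppr0 addr0 !eqxx.
        exact: aux.
      rewrite cabsM cabs_real t1 mulr1 /rho.
      have -> : `|1 - g - 1| = g by rewrite addrAC subrr add0r normrN gtr0_norm.
      lra.
    have Pe : P k * (2 * M) <= e.
      rewrite PE mulrAC ler_pdivrMr; last by rewrite exprn_gt0//; lra.
      have : (del / 2) ^+ 2 <= cabs (a k - rho%:C * t) ^+ 2.
        by rewrite ler_pXn2r// ?nnegrE ?cabs_ge0//; lra.
      move: gM; rewrite !expr2 /rho; move: (cabs _) => x ? ?.
      have ? : e * (del / 2 * (del / 2)) <= e * (x * x) by rewrite ler_pM2l.
      have ? : (1 - (1 - g) * (1 - g)) * (2 * M) <= 2 * g * (2 * M).
        by rewrite ler_wpM2r; nra.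
      nra.
    have := psiM (a k) (a1 k); have := psiM t t1; have := P0 k.
    by rewrite !ler_norml => ? /andP[? ?] /andP[? ?]; nra.
  have : - e * T - e <= N%:R^-1 * \sum_(k < N) (psi (a k) - psi t) * P k.
    have -> : - e * T - e = N%:R^-1 * \sum_(k < N) (- e * P k - e).
      rewrite big_split /= -big_distrr /= sumr_const card_ord mulrDr.
      have -> : N%:R^-1 * (- e *+ N) = - e by rewrite -(mulr_natl (- e) N) mulrA NT mul1r.
      by rewrite /T; congr (_ - _); ring.
    by rewrite ler_pM2l//; apply: ler_sum => k _; exact: term.
  have -> : N%:R^-1 * \sum_(k < N) (psi (a k) - psi t) * P k =
      complex.Re (p t) - psi t * T.
    under eq_bigr do rewrite mulrBl.
    by rewrite big_split /= sumrN -big_distrr /= Rep mulrBr /T; congr (_ - _); ring.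
  have : psi t * (T - 1) >= - e.
    have : `|psi t * (T - 1)| <= e.
      have M4 : `|psi t * (T - 1)| <= M * (4 * rho ^+ N).
        by rewrite normrM; apply: ler_pM => //; exact: psiM.
      have rN0 : 0 <= rho ^+ N by rewrite exprn_ge0.
      by apply: (le_trans M4); move: qM rN0; nra.
    by rewrite ler_norml => /andP[].
  move: T2 e0; nra.
have hE : h 0 = G 0 * cexp (p 0).
  by rewrite /G -mulrA -cexpD addNr cexp0 mulr1.
rewrite hE cabsM cabs_cexp p0 addrC expRD.
by rewrite ler_pM2r ?expR_gt0.
Qed.

End poisson.

(** * Euclidean balls and uniform continuity in C^n *)

Section topology_Cn.
Context (R : realType) (n : nat).
Implicit Types (z w : Cn R n).
Local Open Scope complex_scope.

(** The squared Euclidean distance, a polynomial in the real coordinates. *)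
Definition sqr_dist z w : R := \sum_(k < n) cabs (w ord0 k - z ord0 k) ^+ 2.

Lemma euclid_normE z w : euclid_norm (w - z) = Num.sqrt (sqr_dist z w).
Proof. by congr Num.sqrt; apply: eq_bigr => k _; rewrite !mxE. Qed.

Lemma sqr_dist_ge0 z w : 0 <= sqr_dist z w.
Proof. by apply: sumr_ge0 => k _; exact: sqr_ge0. Qed.

Lemma cabs_le_dist z w k : cabs (w ord0 k - z ord0 k) <= euclid_norm (w - z).
Proof.
rewrite euclid_normE -[leLHS]ger0_norm ?cabs_ge0// -sqrtr_sqr ler_sqrt ?sqr_dist_ge0//.
by rewrite /sqr_dist (bigD1 k)//= lerDl sumr_ge0// => i _; exact: sqr_ge0.
Qed.

Lemma cabs_dist (x y : Cx R) : `|cabs x - cabs y| <= cabs (y - x).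
Proof.
rewrite ler_norml; have := cabsD (y - x) x; have := cabsD (x - y) y.
by rewrite !subrK (cabsB x y) => ? ?; apply/andP; split; lra.
Qed.

(** The topology of C^n in terms of the moduli of the coordinates. *)
Lemma nbhs_CnP z (P : set (Cn R n)) :
  nbhs z P <-> exists2 e : R, (0 < e)%R &
    forall w : Cn R n, (forall k, (cabs (w ord0 k - z ord0 k) < e)%R) -> P w.
Proof.
split=> [/nbhs_ballP[e /= /gt0_complex[e0 ->] eP]|[e e0 eP]].
  exists (complex.Re e) => // w' ww'; apply: eP.
  split=> [|i j]; first by rewrite ltcR.
  rewrite ord1.
  by rewrite -ball_normE /= distrC normc_cabs ltcR.
apply/nbhs_ballP; exists (e%:C)%C; first by rewrite /= ltcR.
move=> w' ww'; apply: eP => k; have [_ /(_ ord0 k)] := ww'.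
by rewrite -ball_normE /= distrC normc_cabs ltcR.
Qed.

Lemma continuous_cabs : continuous (@cabs R : Cx R -> R).
Proof.
move=> x; apply/(@cvgrPdist_lt R R (Cx R) (nbhs x) (nbhs_filter x)) => e e0.
apply/nbhs_cabsP; exists e => // y yx.
exact: le_lt_trans (cabs_dist x y) yx.
Qed.

Lemma continuous_sqr_dist z : continuous (sqr_dist z : Cn R n -> R).
Proof.
have ck k : continuous (fun w : Cn R n => cabs (w ord0 k - z ord0 k) ^+ 2).
  have cc : continuous (fun w : Cn R n => cabs (w ord0 k - z ord0 k)).
    move=> w; apply/(@cvgrPdist_lt R R (Cn R n) (nbhs w) (nbhs_filter w)) => e e0.
    apply/nbhs_CnP; exists e => // w' /(_ k); apply: le_lt_trans.
    apply: le_trans (cabs_dist _ _) _; rewrite opprB addrA subrK.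
    by [].
  by move=> w; exact: (continuous_comp (cc w) (@exprn_continuous R 2 _)).
rewrite /sqr_dist; move: (index_enum _) => s; elim: s => [|k s IH].
  rewrite (_ : (fun w => _) = cst 0); first exact: cst_continuous.
  by apply/funext => w; rewrite big_nil.
rewrite (_ : (fun w => _) = (fun w : Cn R n => cabs (w ord0 k - z ord0 k) ^+ 2 +
    \sum_(i <- s) cabs (w ord0 i - z ord0 i) ^+ 2)).
  by move=> w; exact: (cvgD (ck k w) (IH w)).
by apply/funext => w; rewrite big_cons.
Qed.

Definition closed_euclid_ball z (r : R) : set (Cn R n) :=
  [set w | euclid_norm (w - z) <= r].

Lemma euclid_ball_sub z r : euclid_ball z r `<=` closed_euclid_ball z r.
Proof. by move=> w /ltW. Qed.

Lemma compact_square (c : Cx R) (M : R) :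
  compact [set x : Cx R | `|complex.Re x - complex.Re c| <= M /\
                          `|complex.Im x - complex.Im c| <= M].
Proof.
pose g (p : R * R) : Cx R := p.1 +i* p.2.
have cg : continuous g.
  move=> p; apply/(@cvgrPdist_lt _ (Cx R)) => e /gt0_complex[e0 ->].
  have e2 : 0 < complex.Re e / 2 by rewrite divr_gt0.
  exists (ball p.1 (complex.Re e / 2), ball p.2 (complex.Re e / 2)) => /=.
    by split; exact: nbhsx_ballx.
  move=> q [/= q1 q2]; rewrite normc_cabs ltcR (le_lt_trans (cabs_le_ReIm _))//= /g /=.
  move: q1 q2; rewrite /ball /= => q1 q2; lra.
pose I a := `[a - M, a + M]%classic.
suff -> : [set x : Cx R | `|complex.Re x - complex.Re c| <= M /\
    `|complex.Im x - complex.Im c| <= M] =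
    g @` (I (complex.Re c) `*` I (complex.Im c)).
  apply: continuous_compact; first exact: continuous_subspaceT.
  by apply: compact_setX; exact: segment_compact.
apply/seteqP; split => [[x y] /= [xM yM]|_ [[x y] /= [xM yM] <-]].
  exists (x, y) => //; split; rewrite /I /= in_itv /=; [move: xM|move: yM];
    by rewrite ler_norml => /andP[? ?]; apply/andP; split; lra.
move: xM yM; rewrite /I /= !in_itv /= !ler_norml => /andP[? ?] /andP[? ?].
by split; apply/andP; split; lra.
Qed.

Lemma closed_closed_euclid_ball z (r : R) : 0 <= r -> closed (closed_euclid_ball z r).
Proof.
move=> r0.
have -> : closed_euclid_ball z r = sqr_dist z @^-1` [set x | x <= r ^+ 2].
  apply/seteqP; split => w; rewrite /closed_euclid_ball /= euclid_normE.
    move=> wr; rewrite -(@ler_sqrt _ (sqr_dist z w)) ?sqr_ge0//.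
    by rewrite sqrtr_sqr ger0_norm.
  by move=> wr; rewrite -[leRHS]ger0_norm// -sqrtr_sqr ler_sqrt ?sqr_ge0.
have cc : {in ~` sqr_dist z @^-1` [set x | x <= r ^+ 2], continuous (sqr_dist z)}.
  by move=> u _; exact: continuous_sqr_dist.
exact: (preimage_closed cc (@closed_le R (r ^+ 2))).
Qed.

(** A closed ball is a closed subset of a product of compact squares. *)
Lemma compact_closed_ball z (r : R) : compact (closed_euclid_ball z r).
Proof.
have [r0|r0] := ltP r 0.
  rewrite (_ : closed_euclid_ball z r = set0); first exact: compact0.
  apply/seteqP; split => // w; rewrite /closed_euclid_ball /= => wr.
  by have := le_lt_trans wr r0; rewrite ltNge sqrtr_ge0.
have cK := @closed_closed_euclid_ball z r r0.
have cB := @rV_compact (Cx R) n _ (fun k => @compact_square (z ord0 k) r).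
apply: (subclosed_compact cK cB).
move=> w wr k; have wk := le_trans (cabs_le_dist z w k) wr.
split; rewrite -?ReB -?ImB.
  exact: le_trans (ler_Re_cabs _) wk.
exact: le_trans (ler_Im_cabs _) wk.
Qed.

(** Heine-Cantor, with the modulus of continuity in terms of coordinates. *)
Lemma uniformly_continuous_Cn (K : set (Cn R n)) (psi : Cn R n -> R) (e : R) :
  compact K -> (forall w, K w -> {for w, continuous psi}) -> 0 < e ->
  exists2 del : R, 0 < del & forall w w', K w -> K w' ->
    (forall k, cabs (w' ord0 k - w ord0 k) < del) -> `|psi w' - psi w| <= e.
Proof.
move=> /compact_near_coveringP cK cpsi e0.
pose P (del : R) (w : Cn R n) := forall w', (forall k, cabs (w' ord0 k - w ord0 k) < del) ->
  `|psi w' - psi w| <= e.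
have : \forall del \near 0^'+, K `<=` P del.
  apply: cK => x Kx; have e2 : 0 < e / 2 by rewrite divr_gt0.
  have /cvgrPdist_lt/(_ _ e2)/nbhs_CnP[rho rho0 H] := cpsi _ Kx.
  have rho2 : 0 < rho / 2 by rewrite divr_gt0.
  exists ([set w : Cn R n | forall k, cabs (w ord0 k - x ord0 k) < rho / 2], [set del | del < rho / 2]).
    split => /=; first by apply/nbhs_CnP; exists (rho / 2).
    exact: nbhs_right_lt.
  move=> [w del] /= [wx delr] w' w'w.
  have H1 : `|psi x - psi w| < e / 2.
    by apply: H => k; apply: (lt_le_trans (wx k)); lra.
  have H2 : `|psi x - psi w'| < e / 2.
    apply: H => k; have := cabsD (w' ord0 k - w ord0 k) (w ord0 k - x ord0 k).
    by rewrite addrA subrK; have := w'w k; have := wx k; lra.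
  by move: H1 H2; rewrite !ltr_norml ler_norml; lra.
move=> [del /= del0 delP]; exists (del / 2); first by rewrite divr_gt0.
move=> w w' Kw Kw' ww'; apply: (delP (del / 2)) => //=.
- by rewrite sub0r normrN ger0_norm; lra.
- by rewrite divr_gt0.
Qed.

End topology_Cn.

Local Open Scope ereal_scope.

(** * Product measures and measure-preserving maps *)

Section product.
Context d1 d2 (T1 : measurableType d1) (T2 : measurableType d2) (R : realType).
Variable m1 : {sigma_finite_measure set T1 -> \bar R}.
Variable m2 : {sigma_finite_measure set T2 -> \bar R}.

(** Products of the members of two increasing exhaustions. *)
Lemma product_sigma_finite : exists F : (set (T1 * T2))^nat,
  [/\ setT = \bigcup_k F k, forall k, measurable (F k) &
    forall k, (m1 \x m2) (F k) < +oo].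
Proof.
have /sigma_finiteP[F [FT Fnd Fm]] := sigma_finiteT m1.
have /sigma_finiteP[G [GT Gnd Gm]] := sigma_finiteT m2.
exists (fun k => F k `*` G k); split.
- apply/seteqP; split => // -[x y] _.
  have [i _ Fx] : (\bigcup_k F k) x by rewrite -FT.
  have [j _ Gy] : (\bigcup_k G k) y by rewrite -GT.
  exists (maxn i j) => //; split => /=.
    by move: x Fx; exact/subsetPset/Fnd/leq_maxl.
  by move: y Gy; exact/subsetPset/Gnd/leq_maxr.
- by move=> k; apply: measurableX; [case: (Fm k)|case: (Gm k)].
- move=> k; have [mF Fk] := Fm k; have [mG Gk] := Gm k.
  by rewrite product_measure1E// lte_mul_pinfty// ge0_fin_numE.
Qed.

(** Fubini for a set, with the two orders of integration. *)
Lemma product_measure_swap (A : set (T1 * T2)) : measurable A ->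
  (m1 \x m2) A = \int[m2]_y m1 [set x | A (x, y)].
Proof.
move=> mA; have := indic_fubini_tonelli m1 m2 mA.
rewrite indic_fubini_tonelli_FE// indic_fubini_tonelli_GE// => E.
rewrite /product_measure1 E; apply: eq_integral => y _ /=.
by congr (m1 _); apply/seteqP; split => x /=; rewrite /ysection /= inE.
Qed.

Lemma product_measureE (A : set (T1 * T2)) :
  (m1 \x m2) A = \int[m1]_x m2 [set y | A (x, y)].
Proof.
apply: eq_integral => x _ /=.
by congr (m2 _); apply/seteqP; split => y /=; rewrite /xsection /= inE.
Qed.

Lemma measurable_slice1 (A : set (T1 * T2)) x : measurable A ->
  measurable [set y | A (x, y)].
Proof.
move=> mA; rewrite (_ : [set y | _] = xsection A x); first exact: measurable_xsection.
by apply/seteqP; split => y /=; rewrite /xsection /= inE.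
Qed.

Lemma measurable_slice2 (A : set (T1 * T2)) y : measurable A ->
  measurable [set x | A (x, y)].
Proof.
move=> mA; rewrite (_ : [set x | _] = ysection A y); first exact: measurable_ysection.
by apply/seteqP; split => x /=; rewrite /ysection /= inE.
Qed.

Lemma measurable_fun_slice1 (A : set (T1 * T2)) : measurable A ->
  measurable_fun setT (fun x => m2 [set y | A (x, y)]).
Proof.
move=> mA; rewrite (_ : (fun x => _) = m2 \o xsection A).
  exact: measurable_fun_xsection.
apply/funext => x /=; congr (m2 _).
by apply/seteqP; split => y /=; rewrite /xsection /= inE.
Qed.

End product.

Section preserving.

Definition preserves d (T : measurableType d) (R : realType)
    (m : set T -> \bar R) (phi : T -> T) :=
  measurable_fun setT phi /\
  forall A, measurable A -> m (phi @^-1` A) = m A.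

Context d (T : measurableType d) (R : realType).

Lemma preserves_comp (m : set T -> \bar R) (phi psi : T -> T) :
  preserves m phi -> preserves m psi -> preserves m (psi \o phi).
Proof.
move=> [mphi phiP] [mpsi psiP]; split; first exact: measurableT_comp.
move=> A mA; rewrite comp_preimage phiP ?psiP//.
by rewrite -[X in measurable X]setTI; exact: mpsi.
Qed.

Lemma preserves_integral (m : {measure set T -> \bar R}) (phi : T -> T)
    (D : set T) (g : T -> \bar R) : preserves m phi -> measurable D ->
  measurable_fun D g -> (forall x, D x -> 0 <= g x) ->
  \int[m]_(x in phi @^-1` D) g (phi x) = \int[m]_(x in D) g x.
Proof.
move=> [mphi phiP] mD mg g0.
have -> : \int[m]_(x in phi @^-1` D) g (phi x) =
    \int[pushforward m phi]_(x in D) g x.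
  by rewrite ge0_integral_pushforward// => x; rewrite inE; exact: g0.
by apply: eq_measure_integral => A mA _; exact: phiP.
Qed.

End preserving.

Section preserving_product.
Context d1 d2 (T1 : measurableType d1) (T2 : measurableType d2) (R : realType).
Variable m1 : {sigma_finite_measure set T1 -> \bar R}.
Variable m2 : {sigma_finite_measure set T2 -> \bar R}.

(** A skew product of measure-preserving maps preserves the product measure. *)
Lemma preserves_skew1 (phi : T1 -> T1) (psi : T1 -> T2 -> T2) :
  preserves m1 phi -> (forall x, preserves m2 (psi x)) ->
  measurable_fun setT (fun p : T1 * T2 => psi p.1 p.2) ->
  preserves (m1 \x m2) (fun p => (phi p.1, psi p.1 p.2)).
Proof.
move=> phiP psiP mpsi.
have mP : measurable_fun setT (fun p : T1 * T2 => (phi p.1, psi p.1 p.2)).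
  by apply: measurable_fun_pair => //; apply: measurableT_comp => //; case: phiP.
split => // A mA; rewrite !product_measureE.
rewrite -[RHS](preserves_integral phiP)//; last exact: measurable_fun_slice1.
rewrite preimage_setT.
by apply: eq_integral => x _; exact: (psiP x).2 _ (measurable_slice1 (phi x) mA).
Qed.

(** The same with the roles of the factors exchanged, by Fubini. *)
Lemma preserves_skew2 (psi : T2 -> T1 -> T1) :
  (forall y, preserves m1 (psi y)) ->
  measurable_fun setT (fun p : T1 * T2 => psi p.2 p.1) ->
  preserves (m1 \x m2) (fun p => (psi p.2 p.1, p.2)).
Proof.
move=> psiP mpsi.
have mP : measurable_fun setT (fun p : T1 * T2 => (psi p.2 p.1, p.2)).
  exact: measurable_fun_pair.
split => // A mA; rewrite !product_measure_swap//; last first.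
  by rewrite -[X in measurable X]setTI; exact: mP.
by apply: eq_integral => y _; exact: (psiP y).2 _ (measurable_slice2 y mA).
Qed.

End preserving_product.

Section power_measure_theory.
Context d (T : measurableType d) (R : realType).
Variable mu : {sigma_finite_measure set T -> \bar R}.

Lemma measurable_cons_tuple n :
  measurable_fun setT (fun p : T * n.-tuple T => cons_tuple p.1 p.2).
Proof. by apply: measurable_cons. Qed.

Lemma measurable_cons_preimage n (A : set (n.+1.-tuple T)) : measurable A ->
  measurable [set p : T * n.-tuple T | A (cons_tuple p.1 p.2)].
Proof.
by move=> mA; rewrite -[X in measurable X]setTI; exact: measurable_cons_tuple.
Qed.

Section step.
Variables (n : nat) (m : {sigma_finite_measure set (n.-tuple T) -> \bar R}).

(** The image of the product measure under (x, t) |-> x :: t, which is one step of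
    the recursion defining power_measure. *)
Definition cons_measure (A : set (n.+1.-tuple T)) : \bar R :=
  (mu \x m) [set p | A (cons_tuple p.1 p.2)].

Let cons0 : cons_measure set0 = 0.
Proof. exact: measure0. Qed.

Let cons_ge0 A : 0 <= cons_measure A.
Proof. exact: measure_ge0. Qed.

Let cons_additive : semi_sigma_additive cons_measure.
Proof.
move=> F mF tF mUF; rewrite /cons_measure.
have -> : [set p : T * n.-tuple T | (\bigcup_k F k) (cons_tuple p.1 p.2)] =
    \bigcup_k [set p | F k (cons_tuple p.1 p.2)] by [].
apply: measure_semi_sigma_additive.
- by move=> k; exact: measurable_cons_preimage.
- apply/trivIsetP => i j _ _ ij; rewrite -subset0 => p [/= Fi Fj].
  by move/trivIsetP : tF => /(_ i j I I ij); rewrite -subset0; apply; split; eassumption.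
- by apply: bigcup_measurable => k _; exact: measurable_cons_preimage.
Qed.

HB.instance Definition _ := isMeasure.Build _ _ _ cons_measure
  cons0 cons_ge0 cons_additive.

Let cons_sigma_finite : sigma_finite setT cons_measure.
Proof.
have [F [TF mF Foo]] := product_sigma_finite mu m.
exists (fun k => [set t | F k (thead t, [tuple of behead t])]).
  by apply/seteqP; split => // t _; have : setT (thead t, [tuple of behead t]) by [];
    rewrite TF => -[k _ Fk]; exists k.
move=> k; have mFk := mF k; have Fkoo := Foo k; split.
  rewrite -[X in measurable X]setTI.
  apply: (@measurable_fun_pair _ _ _ _ _ _ (fun t : n.+1.-tuple T => thead t)
    (fun t => [tuple of behead t])) => //; first exact: measurable_tnth.
  exact: measurable_behead.
rewrite /cons_measure (_ : [set p | _] = F k)//; apply/seteqP; split => -[x t] /=.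
  by rewrite theadE (_ : [tuple of _] = t)//; apply/val_inj.
by rewrite theadE (_ : [tuple of _] = t)//; apply/val_inj.
Qed.

HB.instance Definition _ := Measure_isSigmaFinite.Build _ _ _ cons_measure
  cons_sigma_finite.

End step.

(** The set function power_measure, bundled with its measure structure. *)
Fixpoint tuple_measure (n : nat) : {sigma_finite_measure set (n.-tuple T) -> \bar R} :=
  match n with
  | 0 => \d_[tuple]
  | n'.+1 => cons_measure (tuple_measure n')
  end.

Lemma tuple_measureE n : tuple_measure n = power_measure mu (n := n) :> (set _ -> _).
Proof.
by elim: n => // n IH; apply/funext => A; rewrite /= /cons_measure IH.
Qed.

End power_measure_theory.

(** * Rigid motions of the plane and of tuples *)

Section tuple_preserving.
Context d (T : measurableType d) (R : realType).
Variable mu : {sigma_finite_measure set T -> \bar R}.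

Definition tuple_map (n : nat) (phi : 'I_n -> T -> T) (t : n.-tuple T) : n.-tuple T :=
  [tuple phi i (tnth t i) | i < n].

Lemma tuple_map_cons n (phi : 'I_n.+1 -> T -> T) x (t : n.-tuple T) :
  tuple_map phi (cons_tuple x t) =
  cons_tuple (phi ord0 x) (tuple_map (fun i => phi (lift ord0 i)) t).
Proof.
apply: eq_from_tnth => i; rewrite tnth_mktuple.
by case: (unliftP ord0 i) => [j ->|->] //; rewrite !tnthS tnth_mktuple.
Qed.

Lemma preserves_tuple n (phi : 'I_n -> T -> T) : (forall i, preserves mu (phi i)) ->
  preserves (tuple_measure mu n) (tuple_map phi).
Proof.
elim: n phi => [|n IH] phi phiP.
  split=> [|A mA]; first by apply/measurable_fun_tnthP => -[].
  congr (tuple_measure mu 0 _); apply/seteqP; split => t /=.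
    by rewrite (tuple0 t) (tuple0 (tuple_map _ _)).
  by rewrite (tuple0 t) (tuple0 (tuple_map _ _)).
split.
  apply/measurable_fun_tnthP => i.
  rewrite (_ : _ \o _ = phi i \o (fun t : n.+1.-tuple T => tnth t i)).
    by apply: measurableT_comp; [case: (phiP i)|exact: measurable_tnth].
  by apply/funext => t /=; rewrite tnth_mktuple.
move=> A mA; rewrite /= /cons_measure.
have skewP := preserves_skew1 (phiP ord0) (fun=> IH _ (fun i => phiP (lift ord0 i))).
have mS : measurable_fun setT
    (fun p : T * n.-tuple T => tuple_map (fun i => phi (lift ord0 i)) p.2).
  by apply: measurableT_comp => //; case: (IH _ (fun i => phiP (lift ord0 i))).
rewrite -((skewP mS).2 _ (measurable_cons_preimage mA)); congr (_ _).
by apply/seteqP; split => -[x t] /=; rewrite tuple_map_cons.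
Qed.

End tuple_preserving.

Section plane.
Context (R : realType).
Local Notation mu := (@lebesgue_measure R).
Local Notation mu2 := (@lebesgue2 R).

Let lebesgue2_sigma_finite : sigma_finite setT mu2.
Proof.
have [F [FT mF Foo]] := product_sigma_finite mu mu.
by exists F; [exact: FT|move=> k; split; [exact: mF|exact: Foo]].
Qed.

HB.instance Definition _ := Measure_isSigmaFinite.Build _ _ _ mu2 lebesgue2_sigma_finite.

Lemma preserves_translation (a : R) :
  preserves mu (fun x : measurableTypeR R => (x + a)%R).
Proof.
have ma : measurable_fun setT (fun x : measurableTypeR R => (x + a)%R).
  exact: measurable_funD.
split => // A mA.
pose f (x : measurableTypeR R) : measurableTypeR R := (x + a)%R.
pose pm : {measure set (measurableTypeR R) -> \bar R} := pushforward mu f.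
suff H : forall X, ocitv X -> mu X = pm ma X.
  by rewrite (lebesgue_measure_unique H mA).
move=> _ [[p q] _ <-] /=; rewrite /pm /pushforward.
have -> : f @^-1` `]p, q]%classic = `](p - a)%R, (q - a)%R]%classic.
  by apply/seteqP; split => x /=; rewrite !in_itv /= /f ltrBlDr lerBrDr.
by rewrite !lebesgue_measure_itv /= !lte_fin ltrD2r -!EFinB opprB addrA subrK.
Qed.

(** Shears preserve the area because translations preserve the length, and a
    rotation of angle other than pi is a product of three shears; the rotation of
    angle pi is the square of a quarter turn. *)
Lemma preserves_rotation (a b : R) : (a ^+ 2 + b ^+ 2 = 1)%R ->
  preserves mu2 (fun p => (a * p.1 - b * p.2, b * p.1 + a * p.2)%R).
Proof.
have shear1 (k : R) : preserves mu2 (fun p => (p.1 + k * p.2, p.2)%R).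
  apply: (@preserves_skew2 _ _ _ _ _ mu mu (fun y x => (x + k * y)%R)).
    by move=> y; exact: preserves_translation.
  by apply: measurable_funD => //; apply: measurable_funM.
have shear2 (k : R) : preserves mu2 (fun p => (p.1, p.2 + k * p.1)%R).
  apply: (@preserves_skew1 _ _ _ _ _ mu mu idfun (fun x y => (y + k * x)%R)).
  - by split => //; exact: measurable_id.
  - by move=> y; exact: preserves_translation.
  - by apply: measurable_funD => //; apply: measurable_funM.
have rotation (c s : R) : (c ^+ 2 + s ^+ 2 = 1)%R -> (1 + c != 0)%R ->
    preserves mu2 (fun p => (c * p.1 - s * p.2, s * p.1 + c * p.2)%R).
  move=> cs c1; set k := (- s / (1 + c))%R.
  have kc : (k * (1 + c) = - s)%R by rewrite /k mulfVK.
  have ks : (1 + k * s = c)%R.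
    apply: (mulfI c1); have -> : ((1 + c) * (1 + k * s) = 1 + c + s * (k * (1 + c)))%R by ring.
    by rewrite kc; move: cs; lra.
  have := preserves_comp (preserves_comp (shear1 k) (shear2 s)) (shear1 k).
  congr (preserves _ _); apply/funext => -[x y] /=; congr (_, _).
    have -> : (x + k * y + k * (y + s * (x + k * y)) =
      (1 + k * s) * x + k * (1 + (1 + k * s)) * y)%R by ring.
    by rewrite ks kc; ring.
  by rewrite -ks; ring.
move=> ab; have [a1|a1] := eqVneq (1 + a)%R 0%R; last exact: rotation.
have quarter : preserves mu2 (fun p => (0 * p.1 - 1 * p.2, 1 * p.1 + 0 * p.2)%R).
  by apply: rotation; rewrite ?addr0 ?oner_eq0// expr0n expr1n add0r.
have := preserves_comp quarter quarter; congr (preserves _ _).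
have aE : a = (-1)%R by lra.
have b0 : b = 0%R by apply/eqP; rewrite -sqrf_eq0; apply/eqP; move: ab; rewrite aE; lra.
by apply/funext => -[x y] /=; rewrite aE b0; congr (_, _); ring.
Qed.

Lemma preserves_rigid_motion (a b u v : R) : (a ^+ 2 + b ^+ 2 = 1)%R ->
  preserves mu2 (fun p => (a * p.1 - b * p.2 + u, b * p.1 + a * p.2 + v)%R).
Proof.
move=> ab.
have translation : preserves mu2 (fun p => (p.1 + u, p.2 + v)%R).
  apply: (@preserves_skew1 _ _ _ _ _ mu mu (fun x => x + u)%R (fun _ y => y + v)%R).
  - exact: preserves_translation.
  - by move=> _; exact: preserves_translation.
  - exact: measurable_funD.
exact: (preserves_comp (preserves_rotation ab) translation).
Qed.

End plane.

(** * Lebesgue measure on C^n *)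

Section measure_Cn.
Context (R : realType) (n : nat).
Local Notation pm := (tuple_measure (@lebesgue2 R) n).
Local Notation lambda := (lebesgue_Cn R n).
Local Notation toCn := (@toCn R n).

Lemma lebesgue_outerE (A : set (Cn R n)) :
  lebesgue_outer A = (pm^*)%mu (toCn @^-1` A).
Proof. by rewrite /lebesgue_outer -tuple_measureE. Qed.

(** The sigma-algebra of C^n is the one of Caratheodory's theorem. *)
Lemma measurable_CnP (A : set (Cn R n)) :
  measurable A <-> caratheodory_measurable (lebesgue_outer (n := n)) A.
Proof. by split => H; exact: H. Qed.

Lemma measurable_Cn (A : set (Cn R n)) : measurable (toCn @^-1` A) ->
  measurable A.
Proof.
move=> mA; apply/measurable_CnP => X; rewrite !lebesgue_outerE.
have := @sub_caratheodory _ _ _ pm (toCn @^-1` A).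
by apply; exact: sub_sigma_algebra.
Qed.

Lemma lebesgue_CnE (A : set (Cn R n)) : measurable (toCn @^-1` A) ->
  lambda A = pm (toCn @^-1` A).
Proof.
move=> mA; transitivity ((pm^*)%mu (toCn @^-1` A)); first exact: lebesgue_outerE.
exact: (@measurable_mu_extE _ _ _ pm).
Qed.

(** The maps w |-> u w + a, for |u| = 1, include the translations and the rotations
    about a point of all coordinates by the same angle. *)
Definition motion (a : Cn R n) (u : Cx R) (w : Cn R n) : Cn R n := (u *: w + a)%R.

Let motion_coord (a : Cn R n) (u : Cx R) (k : 'I_n)
    (p : measurableTypeR R * measurableTypeR R) :
    measurableTypeR R * measurableTypeR R :=
  (complex.Re u * p.1 - complex.Im u * p.2 + complex.Re (a ord0 k),
   complex.Im u * p.1 + complex.Re u * p.2 + complex.Im (a ord0 k))%R.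

Let motion_coordE a u t :
  motion a u (toCn t) = toCn (tuple_map (motion_coord a u) t).
Proof.
apply/rowP => k; rewrite !mxE tnth_mktuple /motion_coord /=.
case: u => x y; case: (a ord0 k) => b c /=; apply/eqP.
by rewrite eq_complex /= [(x * _ + y * _)%R]addrC !eqxx.
Qed.

(** A motion acts on each coordinate by a rigid motion of the plane, hence maps
    covers to covers of the same total measure. *)
Lemma lebesgue_outer_motion_le a u (A : set (Cn R n)) : cabs u = 1%R ->
  lebesgue_outer (motion a u @^-1` A) <= lebesgue_outer A.
Proof.
move=> u1; rewrite !lebesgue_outerE.
have uP k : preserves (@lebesgue2 R) (motion_coord a u k).
  by apply: preserves_rigid_motion; rewrite -sqr_cabs u1 expr1n.
have [mphi phiP] := preserves_tuple uP.
apply: le_ereal_inf_tmp => _ [F [mF FA] <-].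
apply: ereal_inf_lbound; exists (fun k => tuple_map (motion_coord a u) @^-1` F k).
  split=> [k|t /=]; first by rewrite -[X in measurable X]setTI; exact: mphi.
  rewrite motion_coordE => /FA[k _ Fk]; by exists k.
by apply: eq_eseriesr => k _; exact: phiP.
Qed.

Lemma motionK a u : u != 0%R ->
  cancel (motion a u) (motion (- (u^-1 *: a)) u^-1)%R.
Proof.
by move=> u0 w; rewrite /motion scalerDr scalerA mulVf// scale1r addrK.
Qed.

Lemma motionVK a u : u != 0%R ->
  cancel (motion (- (u^-1 *: a)) u^-1)%R (motion a u).
Proof.
by move=> u0 w; rewrite /motion scalerBr !scalerA mulfV// !scale1r subrK.
Qed.

Lemma lebesgue_outer_motion a u (A : set (Cn R n)) : cabs u = 1%R ->
  lebesgue_outer (motion a u @^-1` A) = lebesgue_outer A.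
Proof.
move=> u1; have u0 : u != 0%R by rewrite -cabs_gt0 u1.
apply/eqP; rewrite eq_le lebesgue_outer_motion_le//=.
have {1}-> : A = motion (- (u^-1 *: a))%R u^-1%R @^-1` (motion a u @^-1` A).
  by apply/seteqP; split => w /=; rewrite (motionVK a u0).
by apply: lebesgue_outer_motion_le; rewrite cabsV u1 invr1.
Qed.

Lemma measurable_motion a u : cabs u = 1%R ->
  measurable_fun setT (motion a u : Cn R n -> Cn R n).
Proof.
move=> u1 _ M /measurable_CnP mM; rewrite setTI; apply/measurable_CnP => X.
have u0 : u != 0%R by rewrite -cabs_gt0 u1.
have {1 2 3}-> : X = motion a u @^-1` (motion (- (u^-1 *: a))%R u^-1%R @^-1` X).
  by apply/seteqP; split => w /=; rewrite (motionK a u0).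
rewrite preimage_setC -!preimage_setI !(fun A => @lebesgue_outer_motion a u A u1).
exact: mM.
Qed.

Lemma preserves_motion a u : cabs u = 1%R ->
  preserves lambda (motion a u : Cn R n -> Cn R n).
Proof.
move=> u1; split; first exact: measurable_motion.
by move=> A _; exact: lebesgue_outer_motion.
Qed.

(** An open set is the union of the boxes with rational data that it contains. *)
Lemma measurable_open (U : set (Cn R n)) : open U -> measurable U.
Proof.
move=> oU; apply: measurable_Cn.
pose box (q : n.-tuple (rat * rat) * rat) : set (n.-tuple (measurableTypeR R * measurableTypeR R)) :=
  \bigcap_(k in [set: 'I_n])
    [set t | (`|(tnth t k).1 - ratr (tnth q.1 k).1| < ratr q.2)%R /\
      (`|(tnth t k).2 - ratr (tnth q.1 k).2| < ratr q.2)%R].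
have -> : toCn @^-1` U =
    \bigcup_q (if pselect (box q `<=` toCn @^-1` U) then box q else set0).
  apply/seteqP; split => [t Ut|t [q _]]; last by case: pselect => [qU /qU|_ []].
  have /nbhs_CnP[e e0 eU] : nbhs (toCn t) U by move: oU; rewrite openE; exact.
  have [r] := rat_in_itvoo (divr_gt0 e0 (ltr0n R 4)).
  rewrite in_itv /= => /andP[r0 re].
  have rr (x : R) : exists q : rat, (`|x - ratr q| < ratr r)%R.
    have [|q] := @rat_in_itvoo R (x - ratr r)%R (x + ratr r)%R; first by lra.
    by rewrite in_itv /= => /andP[xq qx]; exists q; rewrite ltr_norml; lra.
  have [g gP] := choice rr.
  exists ([tuple (g (tnth t k).1, g (tnth t k).2) | k < n], r) => //.
  case: pselect => [_ k _ /=|]; first by rewrite tnth_mktuple /=; split; exact: gP.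
  move=> [] t' tt'; apply: eU => k; rewrite !mxE.
  have := tt' k I; rewrite /= tnth_mktuple /= => -[t1 t2].
  have g1 := gP (tnth t k).1; have g2 := gP (tnth t k).2.
  apply: (le_lt_trans (cabs_le_ReIm _)); rewrite ReB ImB /=.
  have : (`|(tnth t' k).1 - (tnth t k).1| < ratr r + ratr r)%R.
    by move: t1 g1; rewrite !ltr_norml; lra.
  have : (`|(tnth t' k).2 - (tnth t k).2| < ratr r + ratr r)%R.
    by move: t2 g2; rewrite !ltr_norml; lra.
  by move: re; lra.
apply: countable_bigcupT_measurable => // q; case: pselect => [qU|qU] /=; last exact: measurable0.
apply: fin_bigcap_measurable => // k _.
have mk : measurable_fun setT (fun t : n.-tuple (measurableTypeR R * measurableTypeR R) => tnth t k).
  exact: measurable_tnth.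
have near (h : measurableTypeR R * measurableTypeR R -> measurableTypeR R) (c e : R) :
    measurable_fun setT h ->
    measurable [set t : n.-tuple (measurableTypeR R * measurableTypeR R) | (`|h (tnth t k) - c| < e)%R].
  move=> mh; have mhk : measurable_fun setT
    (fun t : n.-tuple (measurableTypeR R * measurableTypeR R) => h (tnth t k)).
    exact: (measurableT_comp mh mk).
  have := mhk measurableT `](c - e)%R, (c + e)%R[%classic (measurable_itv _).
  rewrite setTI; congr measurable; apply/seteqP; split => t /=;
    by rewrite in_itv /= ltr_norml => /andP[? ?]; apply/andP; split; lra.
by apply: measurableI; exact: near.
Qed.

End measure_Cn.

(** * The volume of balls *)

Section ball_volume.
Context (R : realType).
Local Notation mu := (@lebesgue_measure R).
Local Notation mu2 := (@lebesgue2 R).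

Lemma integral_derivative (f F : R -> R) (a b : R) : (a < b)%R ->
  (forall x : R, is_derive x 1%R F (f x)) -> continuous f ->
  \int[mu]_(x in `[a, b]) (f x)%:E = (F b - F a)%:E.
Proof.
move=> ab dF cf.
have cF x : {for x, continuous F}.
  by apply/differentiable_continuous/derivable1_diffP; exact: (@ex_derive _ _ _ _ _ _ _ (dF x)).
rewrite (@continuous_FTC2 _ f F)//.
- exact: continuous_subspaceT.
- split.
  + by move=> x _; exact: (@ex_derive _ _ _ _ _ _ _ (dF x)).
  + exact: cvg_at_right_filter (cF a).
  + exact: cvg_at_left_filter (cF b).
- by move=> x _; rewrite derive1E; exact: (@derive_val _ _ _ _ _ _ _ (dF x)).
Qed.

Lemma is_derive_smul_sin (s x : R) : is_derive x 1%R (fun x => s * sin x)%R (s * cos x)%R.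
Proof.
exact: (is_deriveZ s (is_derive_sin x)).
Qed.

(** The area of a disc, by the substitution x = s sin t. *)
Lemma integral_chord (s : R) : (0 < s)%R ->
  \int[mu]_(x in `[(- s)%R, s]) (2 * Num.sqrt (s ^+ 2 - x ^+ 2))%:E = (pi * s ^+ 2)%:E.
Proof.
move=> s0; have pi0 := pi_gt0 R.
pose F (x : R) := (s * sin x)%R; pose G (x : R) := (2 * Num.sqrt (s ^+ 2 - x ^+ 2))%R.
have dF x := is_derive_smul_sin s x.
have F'E : derive1 F = (fun x => s * cos x)%R.
  by apply/funext => x; rewrite derive1E; exact: (@derive_val _ _ _ _ _ _ _ (dF x)).
have cF' : continuous (fun x => s * cos x)%R.
  by move=> x; apply: cvgM; [exact: cvg_cst|exact: continuous_cos].
have cF x : {for x, continuous F}.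
  by apply: cvgM; [exact: cvg_cst|exact: continuous_sin].
have -> : `[(- s)%R, s]%classic = `[F (- (pi / 2))%R, F (pi / 2)%R]%classic.
  by rewrite /F sinN sin_pihalf mulrN mulr1.
rewrite (@integration_by_substitution_increasing _ F G).
- transitivity (\int[mu]_(x in `[(- (pi / 2))%R, (pi / 2)%R])
      (2 * s ^+ 2 * cos x ^+ 2)%:E).
    apply: eq_integral => x; rewrite inE /= in_itv /= => xpi.
    rewrite F'E /G /F /=; congr (_%:E).
    change (2 * Num.sqrt (s ^+ 2 - (s * sin x) ^+ 2) * (s * cos x) = 2 * s ^+ 2 * cos x ^+ 2)%R.
    have -> : (s ^+ 2 - (s * sin x) ^+ 2 = (s * cos x) ^+ 2)%R.
      rewrite !exprMn; have -> : (sin x ^+ 2 = 1 - cos x ^+ 2)%R by rewrite sin2cos2.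
      by ring.
    rewrite sqrtr_sqr ger0_norm; first by ring.
    by apply: mulr_ge0; [exact: ltW|exact: cos_ge0_pihalf].
  have ab : (- (pi / 2) < pi / 2 :> R)%R by rewrite gtrN// divr_gt0.
  have dH (x : R) : is_derive x 1%R (fun x => s ^+ 2 * (x + sin x * cos x))%R
      (2 * s ^+ 2 * cos x ^+ 2)%R.
    have H := is_deriveZ (s ^+ 2)%R (is_deriveD (is_derive_id x 1%R)
      (is_deriveM (is_derive_sin x) (is_derive_cos x))).
    apply: (is_derive_eq H).
    rewrite /GRing.scale /=.
    have aux (u p q : R) : (q ^+ 2 = 1 - p ^+ 2)%R ->
      (u * (1 + (q * - q + p * p)) = 2 * u * p ^+ 2)%R.
      have -> : (1 + (q * - q + p * p) = 1 - q ^+ 2 + p ^+ 2)%R by ring.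
      by move=> ->; ring.
    exact: (aux _ _ _ (sin2cos2 x)).
  have cH : continuous (fun x : R => 2 * s ^+ 2 * cos x ^+ 2)%R.
    by move=> x; apply: cvgM; [exact: cvg_cst|apply: cvgM; exact: continuous_cos].
  rewrite (integral_derivative ab dH cH).
  rewrite sinN cosN sin_pihalf cos_pihalf; congr (_%:E).
  by rewrite !mulr0 !addr0; field.
- by rewrite lerNl; lra.
- move=> x y; rewrite !in_itv /= => xin yin xy; rewrite /F ltr_pM2l//.
  by rewrite ltr_sin ?in_itv.
- by move=> x _; rewrite F'E; exact: cF'.
- rewrite F'E; apply/cvg_ex; exists (s * cos (- (pi / 2)))%R.
  exact: cvg_at_right_filter (cF' _).
- rewrite F'E; apply/cvg_ex; exists (s * cos (pi / 2))%R.
  exact: cvg_at_left_filter (cF' _).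
- split.
  + by move=> x _; exact: (@ex_derive _ _ _ _ _ _ _ (dF x)).
  + exact: cvg_at_right_filter (cF _).
  + exact: cvg_at_left_filter (cF _).
- apply: continuous_subspaceT => x; apply: cvgM; first exact: cvg_cst.
  have cin : {for x, continuous (fun x : R => s ^+ 2 - x ^+ 2)%R}.
    by apply: cvgB; [exact: cvg_cst|exact: exprn_continuous].
  exact: (continuous_comp cin (@sqrt_continuous R _)).
Qed.

Definition sqr_norm2 (p : measurableTypeR R * measurableTypeR R) : R :=
  (p.1 ^+ 2 + p.2 ^+ 2)%R.

Lemma measurable_sqr_norm2 : measurable_fun setT sqr_norm2.
Proof. by apply: measurable_funD; apply: measurable_funX. Qed.

Lemma measurable_lt d (T : measurableType d) (h : T -> R) (c : R) :
  measurable_fun setT h -> measurable [set t | (h t < c)%R].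
Proof.
move=> mh; have := mh measurableT `]-oo, c[%classic (measurable_itv _).
by rewrite setTI; congr measurable; apply/seteqP; split => t /=; rewrite in_itv.
Qed.

Lemma lebesgue2_disc (c : R) : mu2 [set p | (sqr_norm2 p < c)%R] = (pi * Num.max c 0)%:E.
Proof.
have -> : mu2 [set p | (sqr_norm2 p < c)%R] =
    \int[mu]_x mu [set y : measurableTypeR R | (x ^+ 2 + y ^+ 2 < c)%R].
  exact: product_measureE.
have [c0|c0] := leP c 0%R.
  rewrite mulr0 integral0_eq// => x _; rewrite (_ : [set y | _] = set0)//.
  apply/seteqP; split => // y /=.
  by rewrite ltNge (le_trans c0)// addr_ge0// sqr_ge0.
have [s s0 ->] : exists2 s : R, (0 < s)%R & c = (s ^+ 2)%R.
  by exists (Num.sqrt c); rewrite ?sqrtr_gt0// sqr_sqrtr// ltW.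
rewrite -integral_chord// [RHS]integral_mkcond.
apply: eq_integral => x _; rewrite patchE.
case: ifPn; rewrite ?inE ?notin_setE /= in_itv /= -ler_norml => xs.
  have -> : [set y | (x ^+ 2 + y ^+ 2 < s ^+ 2)%R] =
      `](- Num.sqrt (s ^+ 2 - x ^+ 2))%R, (Num.sqrt (s ^+ 2 - x ^+ 2))%R[%classic.
    apply/seteqP; split => y /=; rewrite in_itv /= -ltr_norml -sqrtr_sqr.
      by move=> xy; have y0 := sqr_ge0 y; rewrite ltr_sqrt; lra.
    have [sx|sx] := ltP 0%R (s ^+ 2 - x ^+ 2)%R.
      by rewrite ltr_sqrt//; lra.
    by rewrite (ler0_sqrtr sx) ltNge sqrtr_ge0.
  rewrite lebesgue_measure_itv /= lte_fin.
  have := sqrtr_ge0 (s ^+ 2 - x ^+ 2)%R; move: (Num.sqrt _) => r r0.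
  case: ltP => [_|r1]; first by rewrite -EFinB opprK -mulr2n mulr_natl.
  have -> : r = 0%R by lra.
  by rewrite mulr0.
rewrite (_ : [set y | _] = set0) ?measure0//; apply/seteqP; split => // y /=.
move=> xy; apply: xs; rewrite -(@ler_pXn2r _ 2)// ?nnegrE ?ltW//.
by rewrite real_normK ?num_real//; have := sqr_ge0 y; lra.
Qed.

(** Both sides are the measure of the region under the graph, by Tonelli. *)
Lemma layer_cake d (T : measurableType d) (m : {sigma_finite_measure set T -> \bar R})
    (Q : T -> R) (c : R) : measurable_fun setT Q -> (forall t, 0 <= Q t)%R ->
  \int[m]_t (Num.max (c - Q t) 0)%:E = \int[mu]_(u in `]0%R, c[) m [set t | (Q t < u)%R].
Proof.
move=> mQ Q0; pose A := [set p : T * measurableTypeR R | (Q p.1 < p.2 < c)%R].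
have mA : measurable A.
  have -> : A = [set p : T * measurableTypeR R | (Q p.1 - p.2 < 0)%R] `&`
      [set p : T * measurableTypeR R | (p.2 < c)%R].
    by apply/seteqP; split => p /=; [move/andP => [? ?]; split => //; lra|
      move=> [? ?]; apply/andP; split => //; lra].
  apply: measurableI; apply: measurable_lt => //.
  by apply: measurable_funB => //; exact: measurableT_comp.
transitivity ((m \x mu) A).
  rewrite product_measureE; apply: eq_integral => t _.
  have -> : [set y | A (t, y)] = `]Q t, c[%classic.
    by apply/seteqP; split => y /=; rewrite in_itv.
  apply/esym/(etrans (lebesgue_measure_itv `]Q t, c[)) => /=.
  rewrite lte_fin; case: ltP => tc.
    by rewrite -EFinB; congr (_%:E); apply/esym/max_idPl; lra.
  by congr (_%:E); apply/esym/max_idPr; lra.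
rewrite product_measure_swap// [RHS]integral_mkcond; apply: eq_integral => u _.
rewrite patchE; case: ifPn; rewrite ?inE ?notin_setE /= in_itv /=.
  move=> /andP[u0 uc]; congr (m _); apply/seteqP; split => t /=; first by case/andP.
  by move=> tu; apply/andP.
move=> uc; rewrite (_ : [set x | _] = set0) ?measure0//; apply/seteqP; split => // t /=.
by rewrite /A /= => /andP[Qu uc']; apply: uc; rewrite (le_lt_trans (Q0 t)).
Qed.

Definition sqr_norm n (t : n.-tuple (measurableTypeR R * measurableTypeR R)) : R :=
  (\sum_(k < n) sqr_norm2 (tnth t k))%R.

Lemma sqr_norm_cons n p (t : n.-tuple (measurableTypeR R * measurableTypeR R)) :
  sqr_norm (cons_tuple p t) = (sqr_norm2 p + sqr_norm t)%R.
Proof.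
rewrite /sqr_norm big_ord_recl; congr (_ + _)%R.
by apply: eq_bigr => k _; rewrite tnthS.
Qed.

Lemma measurable_sqr_norm n : measurable_fun setT (@sqr_norm n).
Proof.
rewrite /sqr_norm; apply: measurable_sum => k.
by apply: (measurableT_comp measurable_sqr_norm2); exact: measurable_tnth.
Qed.

Lemma sqr_norm_ge0 n t : (0 <= @sqr_norm n t)%R.
Proof. by apply: sumr_ge0 => k _; rewrite addr_ge0// sqr_ge0. Qed.

(** Induction on n: splitting off one plane turns the volume into the integral of
    pi (c - |t|^2)^+ over t in C^n, and the layer cake formula turns this into an
    integral of the volumes of smaller balls of C^n. *)
Theorem tuple_measure_ball n (c : R) : (0 < c)%R ->
  tuple_measure mu2 n [set t | (sqr_norm t < c)%R] = (pi ^+ n / n`!%:R * c ^+ n)%:E.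
Proof.
elim: n c => [|n IH] c c0.
  rewrite /= diracE mem_set /= ?expr0 ?fact0 ?divr1 ?mulr1//.
  by rewrite /sqr_norm big_ord0.
rewrite /= /cons_measure.
have -> : [set p : (measurableTypeR R * measurableTypeR R) * n.-tuple _ |
      [set t | (sqr_norm t < c)%R] (cons_tuple p.1 p.2)] =
    [set p | (sqr_norm2 p.1 + sqr_norm p.2 < c)%R].
  by apply/seteqP; split => -[p t]; rewrite /= sqr_norm_cons.
rewrite product_measure_swap; last first.
  apply: measurable_lt; apply: measurable_funD.
    by apply: (measurableT_comp measurable_sqr_norm2).
  by apply: (measurableT_comp (@measurable_sqr_norm n)).
transitivity (\int[tuple_measure mu2 n]_t (pi%:E * (Num.max (c - sqr_norm t) 0)%:E)).
  apply: eq_integral => t _; rewrite -EFinM -lebesgue2_disc; congr (mu2 _).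
  by apply/seteqP; split => p /=; rewrite ltrBrDr.
rewrite ge0_integralZl_EFin ?pi_ge0//; last 2 first.
- by move=> t _; rewrite lee_fin le_max lexx orbT.
- apply/measurable_EFinP; apply: measurable_maxr => //.
  by apply: measurable_funB => //; exact: measurable_sqr_norm.
rewrite layer_cake; [|exact: measurable_sqr_norm|exact: sqr_norm_ge0].
have -> : \int[mu]_(u in `]0%R, c[) tuple_measure mu2 n [set t | (sqr_norm t < u)%R] =
    \int[mu]_(u in `]0%R, c[) (pi ^+ n / n`!%:R * u ^+ n)%:E.
  by apply: eq_integral => u; rewrite inE /= in_itv /= => /andP[u0 _]; exact: IH.
rewrite -(@integral_itv_bndoo _ 0%R c _ true false); last first.
  by apply/measurable_EFinP; apply: measurable_funM => //; exact: measurable_funX.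
have dH (x : R) : is_derive x 1%R (fun u => pi ^+ n / n.+1`!%:R * u ^+ n.+1)%R
    (pi ^+ n / n`!%:R * x ^+ n)%R.
  have H := is_deriveZ (pi ^+ n / n.+1`!%:R)%R (is_deriveX n.+1 (is_derive_id x 1%R)).
  have E : (fun u : R => pi ^+ n / n.+1`!%:R * u ^+ n.+1)%R =
      (pi ^+ n / n.+1`!%:R)%R \*: ((id : R -> R) ^+ n.+1)%R.
    by apply/funext => u; rewrite /= exprfctE.
  rewrite E; apply: (is_derive_eq H); rewrite /GRing.scale /=.
  rewrite factS natrM; field.
  by rewrite nat1r !pnatr_eq0 -lt0n fact_gt0.
have cH : continuous (fun u : R => pi ^+ n / n`!%:R * u ^+ n)%R.
  by move=> x; apply: cvgM; [exact: cvg_cst|exact: exprn_continuous].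
rewrite (integral_derivative c0 dH cH).
rewrite expr0n /= mulr0 subr0 -EFinM; congr (_%:E).
by rewrite !mulrA -exprS.
Qed.

End ball_volume.

(** * Increasing convex functions *)

Section convex_functions.
Context (R : realType) (Phi : \bar R -> \bar R).
Hypothesis Phi_convex : convex_ereal Phi.
Hypothesis Phi_incr : {homo Phi : x y / x < y}.

Let phi (x : R) : R := fine (Phi x%:E).

(** Values at real points lie strictly between the values at -oo and +oo. *)
Lemma increasing_fin_num (x : R) : Phi x%:E \is a fin_num.
Proof.
rewrite fin_numElt; apply/andP; split.
  exact: le_lt_trans (leNye (Phi -oo)) (Phi_incr (ltNyr x)).
exact: lt_le_trans (Phi_incr (ltry x)) (leey (Phi +oo)).
Qed.

Let phiE x : Phi x%:E = (phi x)%:E.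
Proof. by rewrite fineK// increasing_fin_num. Qed.

Let phi_incr x y : (x < y)%R -> (phi x < phi y)%R.
Proof. by move=> xy; rewrite -lte_fin -!phiE; apply: Phi_incr; rewrite lte_fin. Qed.

Let phi_convex x y t : (0 < t < 1)%R ->
  (phi (t * x + (1 - t) * y) <= t * phi x + (1 - t) * phi y)%R.
Proof.
move=> t01; have := @Phi_convex x%:E y%:E t t01; rewrite !phiE -!EFinM -!EFinD.
by rewrite lee_fin; apply.
Qed.

Let phi_slope x m y : (x < m)%R -> (m < y)%R ->
  ((phi m - phi x) / (m - x) <= (phi y - phi m) / (y - m))%R.
Proof.
move=> xm my; have mx0 : (0 < m - x)%R by lra.
have ym0 : (0 < y - m)%R by lra.
have yx0 : (0 < y - x)%R by lra.
have := @phi_convex x y ((y - m) / (y - x))%R.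
have -> : ((y - m) / (y - x) * x + (1 - (y - m) / (y - x)) * y = m)%R.
  by field; lra.
have -> : (1 - (y - m) / (y - x) = (m - x) / (y - x))%R by field; lra.
rewrite divr_gt0//= ltr_pdivrMr// mul1r => /(_ ltac:(lra)).
have -> : ((y - m) / (y - x) * phi x + (m - x) / (y - x) * phi y =
  ((y - m) * phi x + (m - x) * phi y) / (y - x))%R by field; lra.
rewrite ler_pdivlMr// => H.
rewrite ler_pdivrMr// mulrAC ler_pdivlMr//; move: H; lra.
Qed.

(** The slope is the supremum of the slopes of the chords ending at m. *)
Lemma supporting_line (m : R) : exists2 c : R, (0 < c)%R &
  forall x : R, ((fine (Phi m%:E)) + c * (x - m) <= fine (Phi x%:E))%R.
Proof.
pose S := [set (phi m - phi x) / (m - x) | x in [set x | (x < m)%R]]%R.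
have Sub y : (m < y)%R -> ubound S ((phi y - phi m) / (y - m))%R.
  by move=> my _ [x xm <-]; exact: phi_slope.
have m1 : (m - 1 < m)%R by lra.
have Sm1 : S (phi m - phi (m - 1))%R.
  exists (m - 1)%R => //.
  have -> : (m - (m - 1) = 1)%R by ring.
  by rewrite divr1.
have hS : has_sup S.
  split; first by exists (phi m - phi (m - 1))%R.
  by exists ((phi (m + 1) - phi m) / (m + 1 - m))%R; apply: Sub; lra.
have c0 : (0 < sup S)%R.
  apply: (@lt_le_trans _ _ (phi m - phi (m - 1)))%R.
    by rewrite subr_gt0; exact: phi_incr.
  by apply: ub_le_sup Sm1; case: hS.
exists (sup S) => // x; have [xm|mx|->] := ltgtP x m; last by rewrite subrr mulr0 addr0.
  have : ((phi m - phi x) / (m - x) <= sup S)%R.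
    by apply: ub_le_sup; [case: hS|exists x].
  rewrite ler_pdivrMr ?subr_gt0// -/(phi m) -/(phi x); lra.
have : (sup S <= (phi x - phi m) / (x - m))%R.
  by apply: ge_sup; [exists (phi m - phi (m - 1))%R|exact: Sub].
rewrite ler_pdivlMr ?subr_gt0// -/(phi m) -/(phi x); lra.
Qed.

(** A convex increasing function takes all the values above one of its values. *)
Lemma convex_surjective (m A : R) : (fine (Phi m%:E) <= A)%R ->
  exists2 x : R, (m <= x)%R & Phi x%:E = A%:E.
Proof.
move=> mA; have [c c0 cP] := supporting_line m.
pose S := [set x : R | (phi x <= A)%R]; have Sm : S m by [].
have hS : has_ubound S.
  exists (m + (A - phi m) / c)%R => x; rewrite /S /= => xA.
  rewrite -lerBlDl ler_pdivlMr//; have := cP x; rewrite -/(phi x) -/(phi m). lra.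
exists (sup S); first exact: ub_le_sup.
rewrite phiE; congr (_%:E); apply/eqP; rewrite eq_le; apply/andP; split.
  rewrite leNgt; apply/negP => sA; have [k k0 kP] := supporting_line (sup S).
  have d0 : (0 < (phi (sup S) - A) / k)%R by rewrite divr_gt0// subr_gt0.
  have : (sup S <= sup S - (phi (sup S) - A) / k)%R.
    apply: ge_sup; first by exists m.
    move=> x; rewrite /S /= => xA; rewrite lerBrDr -lerBrDl ler_pdivrMr//.
    have := kP x; rewrite -/(phi x) -/(phi (sup S)); lra.
  lra.
rewrite leNgt; apply/negP => sA.
have dphi : (0 < phi (sup S + 1) - phi (sup S))%R.
  by rewrite subr_gt0 phi_incr//; lra.
pose t := Num.min (1 / 2)%R ((A - phi (sup S)) / (phi (sup S + 1) - phi (sup S)))%R.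
have t0 : (0 < t)%R by rewrite lt_min !divr_gt0// subr_gt0.
have t1 : (t < 1)%R by rewrite /t gt_min; apply/orP; left; lra.
have tA : (t * (phi (sup S + 1) - phi (sup S)) <= A - phi (sup S))%R.
  by rewrite -ler_pdivlMr// ge_min lexx orbT.
have : S (sup S + t)%R.
  have := @phi_convex (sup S + 1)%R (sup S) t; rewrite t0 t1 => /(_ isT).
  have -> : (t * (sup S + 1) + (1 - t) * sup S = sup S + t)%R by ring.
  by rewrite /S /=; move: tA; lra.
by move=> /(ub_le_sup hS); lra.
Qed.

End convex_functions.

(** * Averages over a set of finite measure *)

Lemma integrable_cst_finite d (T : measurableType d) (R : realType)
    (mu : {measure set T -> \bar R}) (B : set T) (k : R) :
  measurable B -> mu B < +oo -> mu.-integrable B (EFin \o cst k).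
Proof.
move=> mB B_fin; apply/integrableP; split; first exact/measurable_EFinP.
have -> : \int[mu]_(x in B) `|(EFin \o cst k) x| = `|k|%:E * mu B.
  by rewrite -integral_cst//; exact: eq_integral.
by rewrite lte_mul_pinfty// lee_fin.
Qed.

Section averages.
Context d (T : measurableType d) (R : realType) (mu : {measure set T -> \bar R}).
Variables (B : set T).
Hypotheses (mB : measurable B) (B_fin : mu B < +oo).

Let muBE : mu B = (fine (mu B))%:E.
Proof. by rewrite fineK// ge0_fin_numE. Qed.

Let int_cst (k : R) : \int[mu]_(x in B) k%:E = k%:E * mu B.
Proof. by rewrite -integral_cst. Qed.

(** Since the maps preserve mu and B, the integral of W is also the integral of the
    average of W over these maps. *)
Lemma integral_average_le N (phi : 'I_N -> T -> T) (W : T -> R) (D : R) :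
  (0 < N)%N -> (forall k, preserves mu (phi k)) ->
  (forall k, phi k @^-1` B = B) -> measurable_fun B W ->
  (forall x, B x -> 0 <= W x)%R ->
  (forall x, B x -> \sum_(k < N) W (phi k x) <= N%:R * D)%R ->
  \int[mu]_(x in B) (W x)%:E <= D%:E * mu B.
Proof.
move=> N0 phiP phiB mW W0 WD.
have mWk k : measurable_fun B (EFin \o W \o phi k).
  have [mphi _] := phiP k; apply: (measurable_comp (F := B)) => //.
  - by move=> _ [x Bx <-]; have := Bx; rewrite -{1}(phiB k).
  - exact/measurable_EFinP.
  - exact: measurable_funTS.
have phiB' k x : B x -> B (phi k x) by rewrite -{1}(phiB k).
have Wk k : \int[mu]_(x in B) (W (phi k x))%:E = \int[mu]_(x in B) (W x)%:E.
  have := @preserves_integral _ _ _ mu (phi k) B (EFin \o W) (phiP k) mB.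
  by rewrite phiB; apply => //; exact/measurable_EFinP.
have N0' : (0 < N%:R :> R)%R by rewrite ltr0n.
have : N%:R%:E * \int[mu]_(x in B) (W x)%:E <= N%:R%:E * (D%:E * mu B).
  have -> : N%:R%:E * \int[mu]_(x in B) (W x)%:E =
      \int[mu]_(x in B) \sum_(k < N) (W (phi k x))%:E.
    rewrite ge0_integral_sum//; last by move=> k x Bx; rewrite lee_fin; apply: W0; exact: phiB'.
    rewrite (eq_bigr _ (fun k _ => Wk k)).
    have -> : N%:R%:E = \sum_(k < N) 1%:E :> \bar R.
      by rewrite sumEFin sumr_const card_ord.
    by rewrite ge0_sume_distrl//; apply: eq_bigr => k _; rewrite mul1e.
  rewrite muleA -EFinM -int_cst; apply: ge0_le_integral => //.
  - by move=> x Bx; apply: sume_ge0 => k _; rewrite lee_fin; apply: W0; exact: phiB'.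
  - exact: emeasurable_sum.
  - by move=> x Bx; rewrite sumEFin lee_fin WD.
by rewrite lee_pmul2l.
Qed.

Lemma cvg_truncated_log (C : R) (y : R) : (0 <= y)%R ->
  (C - ln (Num.max y (expR (- n%:R))))%:E @[n --> \oo] --> C%:E - lne y%:E.
Proof.
rewrite le_eqVlt => /orP[/eqP <-|y0].
  rewrite le0_lneNy//= addeC /=.
  rewrite (_ : (fun n => _) = (fun n => (C + n%:R)%:E)); last first.
    apply/funext => n; rewrite (max_idPr _) ?expR_ge0// expRK opprK//.
  apply/cvgeryP/cvgryPge => A; exists (Num.bound `|A - C|%R) => // n /= An.
  rewrite -lerBlDl (le_trans (ler_norm _))//.
  by rewrite (le_trans (ltW (archi_boundP (normr_ge0 _))))// ?ler_nat.
rewrite lne_EFin// -EFinB.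
apply: cvg_near_cst; exists (Num.bound `|- ln y|%R) => // n /= yn.
congr (_%:E); congr (_ - ln _)%R; apply/max_idPl.
rewrite -ler_ln ?posrE ?expR_gt0// expRK lerNl.
by rewrite (le_trans (ler_norm _))// (le_trans (ltW (archi_boundP (normr_ge0 _))))// ?ler_nat.
Qed.

(** Monotone convergence: truncation from below by -m is removed by letting m
    tend to infinity, and integrability of the logarithm comes for free. *)
Lemma integrable_log (F : T -> R) (C K : R) : measurable_fun B F ->
  (forall x, B x -> 0 <= F x)%R ->
  (forall m x, B x -> ln (Num.max (F x) (expR (- m%:R))) <= C)%R ->
  (forall m, \int[mu]_(x in B) (C - ln (Num.max (F x) (expR (- m%:R))))%:E <=
     (C - K)%:E * mu B) ->
  mu.-integrable B (fun x => lne (F x)%:E) /\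
  K%:E * mu B <= \int[mu]_(x in B) lne (F x)%:E.
Proof.
move=> mF F0 FC H.
pose h m x := (C - ln (Num.max (F x) (expR (- m%:R))))%:E.
pose G x := C%:E - lne (F x)%:E.
have hG x : B x -> h ^~ x @ \oo --> G x by move=> Bx; apply: cvg_truncated_log; exact: F0.
have mh m : measurable_fun B (h m).
  apply/measurable_EFinP; apply: measurable_funB => //.
  by apply: measurableT_comp => //; apply: measurable_maxr.
have h0 m x : B x -> 0 <= h m x by move=> Bx; rewrite lee_fin subr_ge0 FC.
have mG : measurable_fun B G by apply: (@emeasurable_fun_cvg _ _ _ _ h) => // x Bx; exact: hG.
have G0 x : B x -> 0 <= G x.
  move=> Bx; rewrite -(cvg_lim _ (hG _ Bx))//; apply: lime_ge.
    by apply/cvg_ex; exists (G x); exact: hG.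
  by apply: nearW => m; exact: h0.
have GE : \int[mu]_(x in B) G x <= (C - K)%:E * mu B.
  have -> : \int[mu]_(x in B) G x = \int[mu]_(x in B) limn (h ^~ x).
    by apply: eq_integral => x; rewrite inE => Bx; apply/esym/cvg_lim => //; exact: hG.
  rewrite monotone_convergence//; last first.
    move=> x Bx m m' mm'; rewrite lee_fin lerD2l lerN2 ler_ln ?posrE; last 2 first.
    - by rewrite lt_max expR_gt0 orbT.
    - by rewrite lt_max expR_gt0 orbT.
    by rewrite ge_max !le_max lexx/= ler_expR lerN2 ler_nat mm' orbT.
  apply: lime_le; last by apply: nearW => m; exact: H.
  apply: ereal_nondecreasing_is_cvgn => m m' mm'; apply: ge0_le_integral => //.
  - exact: h0.
  - move=> x Bx; rewrite lee_fin lerD2l lerN2 ler_ln ?posrE ?lt_max ?expR_gt0 ?orbT//.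
    by rewrite ge_max !le_max lexx/= ler_expR lerN2 ler_nat mm' orbT.
have iG : mu.-integrable B G.
  apply/integrableP; split => //.
  have -> : \int[mu]_(x in B) `|G x| = \int[mu]_(x in B) G x.
    by apply: eq_integral => x; rewrite inE => Bx; rewrite gee0_abs// G0.
  apply: (le_lt_trans GE); rewrite -ge0_fin_numE.
    by rewrite fin_numM// ge0_fin_numE.
  by apply: le_trans GE; exact: integral_ge0.
have lE x : lne (F x)%:E = C%:E - G x by rewrite /G oppeB ?fin_num_adde_defr// addeA subee// add0e.
have -> : (fun x => lne (F x)%:E) = (EFin \o cst C) \- G by apply/funext => x; rewrite /= -lE.
have iC : mu.-integrable B (EFin \o cst C) by exact: integrable_cst_finite.
split; first exact: integrableB.
rewrite integralB//= int_cst leeBrDr ?integrable_fin_num//.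
apply: (le_trans (leeD2l _ GE)).
rewrite muBE.
by rewrite -!EFinM -EFinD lee_fin -mulrDl addrC subrK.
Qed.

End averages.

(** * Jensen's inequality *)

Section jensen.
Context d (T : measurableType d) (R : realType) (mu : {measure set T -> \bar R}).

(** The supporting line at the mean m of f - g on B lies below Phi, and its
    integral over B is Phi(m) times the measure of B; positive parts are compared
    because Phi (f - g) is only known to be nonnegative almost everywhere. *)
Lemma jensen (Phi : \bar R -> \bar R) (D B : set T) (f g : T -> \bar R) (m : R) :
  convex_ereal Phi -> {homo Phi : x y / x < y} ->
  measurable D -> measurable B -> B `<=` D -> mu B < +oo ->
  mu.-integrable B f -> mu.-integrable B g ->
  \int[mu]_(x in B) f x - \int[mu]_(x in B) g x = m%:E * mu B ->
  measurable_fun D (fun x => Phi (f x - g x)) ->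
  {ae mu, forall x, D x -> 0 <= Phi (f x - g x)} ->
  Phi m%:E * mu B <= \int[mu]_(x in D) Phi (f x - g x).
Proof.
move=> cPhi iPhi mD mB BD Bfin if_ ig mE mP P0.
have [c c0 cP] := supporting_line cPhi iPhi m.
set p := fine (Phi m%:E) in cP.
have pE : Phi m%:E = p%:E by rewrite fineK// increasing_fin_num.
pose P x := Phi (f x - g x).
pose L x := (p - c * m)%:E + c%:E * (f x - g x).
have icst (k : R) : mu.-integrable B (EFin \o cst k) by exact: integrable_cst_finite.
have ifg : mu.-integrable B (f \- g) by exact: integrableB.
have icfg : mu.-integrable B (fun x => c%:E * (f x - g x)) by exact: integrableZl.
have iL : mu.-integrable B L by exact: (integrableD mB (icst (p - c * m)%R) icfg).
have muB : mu B = (fine (mu B))%:E by rewrite fineK// ge0_fin_numE.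
have LE : \int[mu]_(x in B) L x = Phi m%:E * mu B.
  rewrite (integralD mB (icst (p - c * m)%R) icfg) integralZl// integralB// mE.
  have -> : \int[mu]_(x in B) (EFin \o cst (p - c * m)%R) x = (p - c * m)%:E * mu B.
    by rewrite -integral_cst.
  by rewrite pE muB -!EFinM -EFinD; congr (_%:E); ring.
rewrite -LE.
have mPp : measurable_fun D P^\+ by exact: measurable_funepos.
have -> : \int[mu]_(x in D) Phi (f x - g x) = \int[mu]_(x in D) P^\+ x.
  apply: ae_eq_integral => //.
  apply: filterS P0 => x H Dx; rewrite funeposE.
  by apply/esym/max_idPl; exact: H.
apply: (@le_trans _ _ (\int[mu]_(x in B) L^\+ x)).
  rewrite integralE; have : 0 <= \int[mu]_(x in B) L^\- x by exact: integral_ge0.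
  by move=> ?; rewrite leeBlDr ?integrable_neg_fin_num// leeDl.
apply: (@le_trans _ _ (\int[mu]_(x in B) P^\+ x)); last first.
  by apply: ge0_subset_integral.
apply: ae_ge0_le_integral => //.
- by apply: measurable_funepos; exact: (measurable_int mu).
- exact: measurable_funS mPp.
have := integrable_ae mB if_; have := integrable_ae mB ig.
apply: filterS2 => x /[swap] + /[swap] Bx => /(_ Bx) fx /(_ Bx) gx.
suff LP : L x <= P x by rewrite !funeposE ge_max !le_max lexx orbT LP.
rewrite /L /P; move: fx gx; case: (f x) => [r| |]//; case: (g x) => [s| |]// _ _.
rewrite -EFinB -EFinM -EFinD -[leRHS]fineK; last exact: increasing_fin_num.
by rewrite lee_fin (le_trans _ (cP _))// le_eqVlt; apply/orP; left; apply/eqP; ring.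
Qed.

End jensen.

(** * Balls and rotations in C^n *)

Section balls.
Context (R : realType) (n : nat).
Implicit Types (z w : Cn R n).
Local Notation lambda := (lebesgue_Cn R n).

Lemma euclid_ballE z (r : R) : (0 < r)%R ->
  euclid_ball z r = [set w | (sqr_dist z w < r ^+ 2)%R].
Proof.
move=> r0; apply/seteqP; split => w; rewrite /euclid_ball /= euclid_normE => wr.
  rewrite ltNge; apply/negP => rw; move: wr; rewrite ltNge => /negP; apply.
  by rewrite -[leLHS](ger0_norm (ltW r0)) -sqrtr_sqr ler_sqrt ?sqr_dist_ge0.
by rewrite -[ltRHS](ger0_norm (ltW r0)) -sqrtr_sqr ltr_sqrt ?exprn_gt0.
Qed.

Lemma open_euclid_ball z (r : R) : (0 < r)%R -> open (euclid_ball z r).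
Proof.
move=> r0; rewrite euclid_ballE//.
have cc : {in sqr_dist z @^-1` [set x | (x < r ^+ 2)%R], continuous (sqr_dist z)}.
  by move=> u _; exact: continuous_sqr_dist.
exact: (open_comp cc (@open_lt R (r ^+ 2)%R)).
Qed.

Lemma measurable_euclid_ball z (r : R) : (0 < r)%R -> measurable (euclid_ball z r).
Proof. by move=> r0; apply: measurable_open; exact: open_euclid_ball. Qed.

(** The map w |-> z + u (w - z). *)
Definition rotation z (u : Cx R) : Cn R n -> Cn R n := motion (z - u *: z)%R u.

Lemma rotationE z u w : rotation z u w = (z + u *: (w - z))%R.
Proof. by rewrite /rotation /motion scalerBr addrCA. Qed.

Lemma sqr_dist_rotation z u w :
  sqr_dist z (rotation z u w) = (cabs u ^+ 2 * sqr_dist z w)%R.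
Proof.
rewrite /sqr_dist big_distrr /=; apply: eq_bigr => k _.
by rewrite rotationE !mxE [(z ord0 k + _)%R]addrC addrK cabsM exprMn.
Qed.

Lemma preimage_rotation_ball z u (r : R) : cabs u = 1%R ->
  rotation z u @^-1` euclid_ball z r = euclid_ball z r.
Proof.
move=> u1; apply/seteqP; split => w;
  by rewrite /euclid_ball /= !euclid_normE sqr_dist_rotation u1 expr1n mul1r.
Qed.

Theorem volume_euclid_ball z (r : R) : (0 < r)%R ->
  lambda (euclid_ball z r) = (pi ^+ n / n`!%:R * r ^+ (2 * n))%:E.
Proof.
move=> r0; have -> : euclid_ball z r = motion (- z)%R 1%R @^-1` euclid_ball 0%R r.
  by apply/seteqP; split => w; rewrite /euclid_ball /= /motion scale1r subr0.
transitivity (lambda (euclid_ball (0%R : Cn R n) r)).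
  by apply: lebesgue_outer_motion; exact: cabs1.
have E : @toCn R n @^-1` euclid_ball 0%R r = [set t | (sqr_norm t < r ^+ 2)%R].
  rewrite euclid_ballE//; apply/seteqP; split => t /=;
  rewrite (_ : sqr_dist _ _ = sqr_norm t)//; apply: eq_bigr => k _;
  by rewrite !mxE subr0 sqr_cabs.
have mE : measurable (@toCn R n @^-1` euclid_ball 0%R r).
  by rewrite E; apply: measurable_lt; exact: measurable_sqr_norm.
rewrite (lebesgue_CnE mE) E tuple_measure_ball ?exprn_gt0//.
by rewrite -exprM.
Qed.

Lemma measurable_fun_continuous (B : set (Cn R n)) (F : Cn R n -> R) :
  open B -> (forall w, B w -> {for w, continuous F}) -> measurable_fun B F.
Proof.
move=> oB cF; apply: (measurability _ (RGenOInfty.measurableE R)) => _ [_ [x ->] <-].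
apply: measurable_open; rewrite openE => w [Bw xF].
have nB : nbhs w B by move: oB; rewrite openE; exact.
apply: filterI => //.
have : nbhs (F w) `]x, +oo[%classic by apply: open_nbhs_nbhs; split.
exact: cF.
Qed.

End balls.

(** * Subharmonicity of ln |f| *)

Section submean.
Context (R : realType) (n : nat) (O : set (Cn R n)) (f : Cn R n -> Cx R).
Context (z : Cn R n) (r : R).
Hypotheses (f_hol : holomorphic_on O f) (r0 : (0 < r)%R).
Hypothesis ball_sub : closed_euclid_ball z r `<=` O.
Local Notation lambda := (lebesgue_Cn R n).
Local Notation B := (euclid_ball z r).

Lemma slice_in_ball w (t : Cx R) : B w -> (cabs t <= 1)%R ->
  closed_euclid_ball z r (rotation z t w).
Proof.
move=> Bw t1; rewrite /closed_euclid_ball /= euclid_normE sqr_dist_rotation.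
rewrite sqrtrM ?sqr_ge0// sqrtr_sqr ger0_norm ?cabs_ge0// -euclid_normE.
rewrite -[leRHS]mul1r ler_pM ?cabs_ge0 ?sqrtr_ge0//.
exact: ltW.
Qed.

Lemma differentiable_slice w (t : Cx R) : B w -> (cabs t <= 1)%R ->
  differentiable (fun t : Cx R => f (rotation z t w)) t.
Proof.
move=> Bw t1.
have -> : (fun t : Cx R => f (rotation z t w)) =
    f \o (fun t : Cx R => (z + t *: (w - z))%R : Cn R n).
  by apply/funext => u; rewrite /= rotationE.
apply: differentiable_comp.
  apply: differentiableD; first exact: differentiable_cst.
  by apply: differentiableZl; exact: ex_diff.
by rewrite -rotationE; apply: f_hol; apply: ball_sub; exact: slice_in_ball.
Qed.

(** Truncation from below keeps ln |f| finite and continuous at the zeros of f. *)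
Definition log_trunc (eta : R) (w : Cn R n) : R := ln (Num.max (cabs (f w)) eta).

Lemma continuous_modulus w : O w -> {for w, continuous (fun w => cabs (f w))}.
Proof.
move=> Ow; have cf := differentiable_continuous (f_hol Ow).
exact: (continuous_comp cf (@continuous_cabs R _)).
Qed.

Lemma continuous_log_trunc eta w : (0 < eta)%R -> O w ->
  {for w, continuous (log_trunc eta)}.
Proof.
move=> eta0 Ow.
have cm : {for w, continuous (fun w => Num.max (cabs (f w)) eta)}.
  exact: (continuous_max (continuous_modulus Ow) (@cst_continuous _ _ eta w)).
have c0 : (0 < Num.max (cabs (f w)) eta)%R by rewrite lt_max eta0 orbT.
exact: (continuous_comp cm (continuous_ln c0)).
Qed.

(** On each complex line through z, the value at z is bounded by the average over
    the vertices of a regular polygon, up to 4 e; averaging over the rotations of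
    the ball turns this into a bound by the mean over the ball. *)
Lemma log_trunc_average (eta C : R) : (0 < eta)%R -> f z != 0%R ->
  (forall w, closed_euclid_ball z r w -> log_trunc eta w <= C)%R ->
  \int[lambda]_(w in B) (C - log_trunc eta w)%:E <=
    (C - ln (cabs (f z)))%:E * lambda B.
Proof.
move=> eta0 fz0 psiC; set K := ln (cabs (f z)).
have fz : (0 < cabs (f z))%R by rewrite cabs_gt0.
have lB := volume_euclid_ball z r0.
have Bz : B z by rewrite euclid_ballE//= /sqr_dist big1 ?exprn_gt0// => k _; rewrite subrr cabs0 expr0n.
set b := (_ * _)%R in lB.
have b0 : (0 <= b)%R by rewrite -lee_fin -lB.
have Bfin : lambda B < +oo by rewrite lB ltry.
have mB : measurable B := measurable_euclid_ball z r0.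
have psi_ge w : (ln eta <= log_trunc eta w)%R.
  by rewrite ler_ln ?posrE ?lt_max ?eta0 ?orbT// le_max lexx orbT.
have mpsi : measurable_fun B (fun w => C - log_trunc eta w)%R.
  apply: measurable_funB => //; apply: measurable_fun_continuous.
    exact: open_euclid_ball.
  move=> w Bw; apply: continuous_log_trunc => //.
  by apply: ball_sub; exact: euclid_ball_sub.
have key (e : R) : (0 < e)%R ->
    \int[lambda]_(w in B) (C - log_trunc eta w)%:E <= (C - K + 4 * e)%:E * lambda B.
  move=> e0.
  have [del del0 delP] := uniformly_continuous_Cn (@compact_closed_ball _ _ z r)
    (fun w Kw => continuous_log_trunc eta0 (ball_sub Kw)) e0.
  have M0 : (0 <= `|C| + `|ln eta|)%R by rewrite addr_ge0.
  have [N N0 HN] := log_submean_roots e0 (divr_gt0 del0 r0) M0.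
  apply: (@integral_average_le _ _ _ lambda B mB N
    (fun k => rotation z (root_of_unity R N ^+ k)%R)); [exact: N0| | |exact: mpsi| |].
  - by move=> k; apply: preserves_motion; exact: cabs_root_of_unity.
  - by move=> k; apply: preimage_rotation_ball; exact: cabs_root_of_unity.
  - by move=> w Bw; rewrite subr_ge0; apply: psiC; exact: euclid_ball_sub.
  move=> w Bw.
  have := HN (fun t => f (rotation z t w)) (fun t => log_trunc eta (rotation z t w)).
  have -> : rotation z 0%R w = z by rewrite rotationE scale0r addr0.
  have H1 t : (cabs t <= 1)%R -> differentiable (fun t : Cx R => f (rotation z t w)) t.
    exact: differentiable_slice.
  have H2 t : (cabs t = 1 -> `|log_trunc eta (rotation z t w)| <= `|C| + `|ln eta|)%R.
    move=> t1; have t1' : (cabs t <= 1)%R by rewrite t1.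
    have := psiC _ (slice_in_ball Bw t1'); have := psi_ge (rotation z t w).
    have := ler_norm C; have := ler_norm (- ln eta); rewrite normrN => *.
    have := normr_ge0 C; have := normr_ge0 (ln eta).
    by rewrite ler_norml => *; apply/andP; split; lra.
  have H3 t t' : (cabs t = 1 -> cabs t' = 1 -> cabs (t' - t) < del / r ->
      `|log_trunc eta (rotation z t' w) - log_trunc eta (rotation z t w)| <= e)%R.
    move=> t1 t1' tt'; apply: delP.
    - by apply: slice_in_ball => //; rewrite t1.
    - by apply: slice_in_ball => //; rewrite t1'.
    move=> k; rewrite !rotationE !mxE opprD addrACA subrr add0r -mulrBl cabsM.
    have wk : (cabs (w ord0 k - z ord0 k) <= r)%R.
      by apply: (le_trans (cabs_le_dist z w k)); exact: ltW.
    rewrite ltr_pdivlMr// in tt'; apply: le_lt_trans tt'.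
    by rewrite ler_wpM2l// cabs_ge0.
  have H4 t : (cabs t = 1 -> cabs (f (rotation z t w)) <= expR (log_trunc eta (rotation z t w)))%R.
    move=> t1; rewrite /log_trunc lnK ?posrE ?lt_max ?eta0 ?orbT//.
    by rewrite le_max lexx.
  move=> /(_ H1 H2 H3 H4) H.
  have {}H : (K <= N%:R^-1 * \sum_(k < N) log_trunc eta (rotation z (root_of_unity R N ^+ k) w) + 4 * e)%R.
    by rewrite -ler_expR lnK.
  rewrite big_split /= sumr_const card_ord sumrN -(mulr_natl C).
  have NT : (0 < N%:R :> R)%R by rewrite ltr0n.
  move: H; set S := (\sum_(k < N) _)%R => H.
  have -> : (N%:R * C - S = N%:R * (C - N%:R^-1 * S))%R.
    by rewrite mulrBr mulrA mulfV ?mul1r// gt_eqF.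
  by rewrite ler_pM2l//; move: H; lra.
apply/lee_addgt0Pr => e e0.
have d0 : (0 < e / (4 * (b + 1)))%R by rewrite divr_gt0// mulr_gt0//; lra.
apply: (le_trans (key _ d0)); rewrite lB -!EFinM -EFinD lee_fin mulrDl lerD2l.
have -> : (4 * (e / (4 * (b + 1))) * b = e * (b / (b + 1)))%R by field; lra.
by rewrite -[leRHS]mulr1 ler_pM2l// ler_pdivrMr; lra.
Qed.

(** The truncation levels tend to -oo; f is bounded on the compact closed ball,
    which provides the common upper bound C. *)
Theorem log_modulus_submean : f z != 0%R ->
  lambda.-integrable B (log_abs f) /\
  (ln (cabs (f z)))%:E * lambda B <= \int[lambda]_(w in B) log_abs f w.
Proof.
move=> fz0; have lB := volume_euclid_ball z r0.
have Kz : closed_euclid_ball z r z.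
  by rewrite /closed_euclid_ball /= euclid_normE /sqr_dist big1 ?sqrtr0 ?ltW// => k _;
    rewrite subrr cabs0 expr0n.
have cF : {within closed_euclid_ball z r, continuous (fun w => cabs (f w))}.
  by apply: continuous_in_subspaceT => w; rewrite inE => Kw;
    apply: continuous_modulus; exact: ball_sub.
have [c _ cmax] := compact_EVT_max (ex_intro _ z Kz) (@compact_closed_ball _ _ z r) cF.
pose C := ln (Num.max (cabs (f c)) 1%R).
have psiC m w : closed_euclid_ball z r w -> (log_trunc (expR (- m%:R)) w <= C)%R.
  move=> Kw; rewrite ler_ln ?posrE ?lt_max ?expR_gt0 ?ltr01 ?orbT//.
  have e1 : (expR (- m%:R) <= 1 :> R)%R.
    by rewrite -[leRHS]expR0 ler_expR oppr_le0 ler0n.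
  by rewrite ge_max !le_max cmax ?inE//= e1 orbT.
have Bfin : lambda B < +oo by rewrite lB ltry.
apply: (@integrable_log _ _ _ lambda B (measurable_euclid_ball z r0) Bfin _ C).
- apply: measurable_fun_continuous; first exact: open_euclid_ball.
  by move=> w Bw; apply: continuous_modulus; apply: ball_sub; exact: euclid_ball_sub.
- by move=> w _; exact: cabs_ge0.
- by move=> m w Bw; apply: psiC; exact: euclid_ball_sub.
- by move=> m; exact: (log_trunc_average (expR_gt0 _) fz0 (psiC m)).
Qed.

End submean.

(** * The inequality *)

Theorem mainTheorem2 (R : realType) (n : nat) (O : set (Cn R n))
    (v : Cn R n -> \bar R) (Phi PhiI : \bar R -> \bar R)
    (f : Cn R n -> Cx R) :
  (0 < n)%N ->
  open O ->
  locally_integrable_on O v ->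
  convex_ereal Phi ->
  {homo Phi : x y / x < y} ->
  cancel Phi PhiI ->
  holomorphic_on O f ->
  has_integral O (fun w => Phi (log_abs f w - v w)) ->
  (* Not in the source. For a Phi taking negative values the source's claim is
     false: n = 1, O the disc of radius 2, Phi = id, f = 1, v = 0 on the unit
     disc and v = 100 elsewhere, z = 0, r = 1. *)
  {ae lebesgue_Cn R n, forall w, O w -> 0 <= Phi (log_abs f w - v w)} ->
  N_Phi Phi O f v < +oo ->
  forall z : Cn R n, O z ->
    log_abs f z <=
    ereal_inf [set ball_mean v z r +
                   PhiI ((n`!%:R / (pi ^+ n * r ^+ (2 * n)))%:E * N_Phi Phi O f v)
              | r in [set r : R | (0 < r)%R /\ r%:E < euclid_dist z (~` O)]].
Proof.
move=> _ openO [_ iv] cPhi iPhi PhiK f_hol [mP _] P0 Nfin z Oz.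
(* A zero of f makes the left-hand side -oo. *)
have [fz0|fz0] := eqVneq (f z) 0%R.
  by rewrite /log_abs fz0 cabs0 le0_lneNy// leNye.
apply: le_ereal_inf_tmp => _ [r [r0 rdist] <-].
have ball_sub : closed_euclid_ball z r `<=` O.
  move=> w wr; apply: contrapT => Ow; move: rdist; rewrite ltNge => /negP; apply.
  apply: (@le_trans _ _ (euclid_norm (w - z)%R)%:E); last by rewrite lee_fin.
  by apply: ereal_inf_lbound; exists w.
have [ilog submean] := log_modulus_submean f_hol r0 ball_sub fz0.
have lB := volume_euclid_ball z r0.
have mB := measurable_euclid_ball z r0.
have BK := @euclid_ball_sub _ _ z r.
have BO : euclid_ball z r `<=` O by apply: subset_trans ball_sub.
have ivB : (lebesgue_Cn R n).-integrable (euclid_ball z r) v.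
  have mK : measurable (closed_euclid_ball z r).
    rewrite -[X in measurable X]setCK; apply: measurableC; apply: measurable_open.
    by apply: closed_openC; apply: closed_closed_euclid_ball; exact: ltW.
  exact: (integrableS mK mB BK (iv _ (@compact_closed_ball _ _ z r) ball_sub)).
set b := (_ * _)%R in lB.
have b0 : (0 < b)%R.
  by rewrite /b mulr_gt0 ?exprn_gt0// divr_gt0 ?exprn_gt0 ?pi_gt0// ltr0n fact_gt0.
have bV : (n`!%:R / (pi ^+ n * r ^+ (2 * n)) = b^-1 :> R)%R.
  by rewrite /b !invfM invrK mulrA [(n`!%:R * _)%R]mulrC.
have ilogE := fineK (integrable_fin_num mB ilog).
have ivE := fineK (integrable_fin_num mB ivB).
rewrite /ball_mean lB bV.
set Il := fine _ in ilogE; set Iv := fine _ in ivE.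
(* The mean of ln |f| - v over the ball. *)
pose m := ((Il - Iv) / b)%R.
have mE : \int[lebesgue_Cn R n]_(x in euclid_ball z r) log_abs f x -
    \int[lebesgue_Cn R n]_(x in euclid_ball z r) v x = m%:E * lebesgue_Cn R n (euclid_ball z r).
  by rewrite -ilogE -ivE lB -EFinB -EFinM /m divfK// gt_eqF.
have Bfin : lebesgue_Cn R n (euclid_ball z r) < +oo by rewrite lB ltry.
have J : Phi m%:E * lebesgue_Cn R n (euclid_ball z r) <= N_Phi Phi O f v.
  exact: (jensen cPhi iPhi (measurable_open openO) mB BO Bfin ilog ivB mE mP P0).
rewrite lB in J.
have PhiE := fineK (increasing_fin_num iPhi m).
rewrite -PhiE -EFinM in J.
have NE : N_Phi Phi O f v = (fine (N_Phi Phi O f v))%:E.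
  by rewrite fineK// fin_numElt Nfin (lt_le_trans _ J)// ltNyr.
rewrite NE lee_fin in J *; rewrite -EFinM.
(* The argument of PhiI is a value of Phi, at a point x above m. *)
have /(convex_surjective cPhi iPhi)[x mx <-] :
    (fine (Phi m%:E) <= b^-1 * fine (N_Phi Phi O f v))%R.
  by rewrite mulrC ler_pdivlMr.
rewrite PhiK -ivE /= -EFinM -EFinD /log_abs lne_EFin ?cabs_gt0// lee_fin.
rewrite -ilogE lB -EFinM lee_fin in submean.
apply: (@le_trans _ _ (b^-1 * Iv + m)%R); last by rewrite lerD2l.
have -> : (b^-1 * Iv + m = Il / b)%R by rewrite /m; field; rewrite gt_eqF.
by rewrite ler_pdivlMr.
Qed.
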